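(* Let $\mathbb{K}$ be a field of characteristic $0$ and let $G$ be a finite abelian group acting diagonally on $V=\mathbb{K}^n$ ($n\ge1$) with respect to a basis $v_1,\dots,v_n$, with ${}^gv_i=\chi_i(g)v_i$. Suppose that $\mathcal{H}_{\mathbf{q},\kappa}$ is a quantum Drinfeld orbifold algebra for some parameter function $\kappa:V\times V\to V\otimes\mathbb{K}G$ satisfying the vanishing condition. Let $A=\mathbb{Z}^n\times G$ and consider $L=V\otimes\mathbb{K}G$ as an $A$-graded vector space via $|v_i|=(a_i,1_G)$, $|g|=(0,g)$, $|v_i\otimes g|=|v_i||g|$ for $g\in G$, where $a_1,\dots,a_n$ is the standard basis of $\mathbb{Z}^n$. Then: (a) There is an antisymmetric bicharacter $\epsilon:A\times A\to\mathbb{K}^*$ with $$\epsilon\big(|v_i\otimes g|,|v_j\otimes h|\big)=q_{ij}\,\chi_i^{-1}(h)\,\chi_j(g)\quad\text{for } g,h\in G,\ 1\le i,j\le n.$$ (b) The space $L$ is an ungraded Yetter-Drinfeld $(A,\epsilon)$-color Lie ring over $\mathbb{K}G$ for the color Lie bracket $[\,,\,]:L\times L\to L$ defined by $$[v_i\otimes g,v_j\otimes h]=\kappa(v_i,{}^gv_j)\,gh\quad\text{for } g,h\in G,\ 1\le i,j\le n.$$ (c) The algebra $\mathcal{H}_{\mathbf{q},\kappa}$ is isomorphic to the universal enveloping algebra $\mathcal{U}(L)$ of $L$.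
   Context: Conventions: $\otimes=\otimes_{\mathbb{K}}$; $\mathbb{N}$ contains $0$; $(v\otimes h)g=v\otimes hg$ is right multiplication by $g\in G$ on $V\otimes\mathbb{K}G$. Quantum Drinfeld orbifold algebras. A quantum system of parameters is $\mathbf{q}=\{q_{ij}\}_{1\le i,j\le n}\subset\mathbb{K}^*$ with $q_{ii}=1$, $q_{ji}=q_{ij}^{-1}$. A parameter function is a bilinear map $\kappa:V\times V\to V\otimes\mathbb{K}G$ with $\kappa(v_i,v_j)=-q_{ij}\kappa(v_j,v_i)$. The skew group algebra $T(V)\rtimes G$ is $T(V)\otimes\mathbb{K}G$ with product $(r\,g)(s\,h)=r({}^gs)\,gh$, and $\mathcal{H}_{\mathbf{q},\kappa}=(T(V)\rtimes G)/(v_iv_j-q_{ij}v_jv_i-\kappa(v_i,v_j):1\le i,j\le n)$. It is a quantum Drinfeld orbifold algebra if it satisfies the PBW property: the image of $\{v_1^{m_1}\cdots v_n^{m_n}g:m_i\in\mathbb{N},g\in G\}$ is a $\mathbb{K}$-basis. Vanishing condition: for all $g\in G$, all distinct $1\le i,j,k\le n$, and all $1\le r\le n$, ${}^gv_k=q_{ik}q_{jk}q_{kr}\,v_k$ whenever the coefficient of $v_r\otimes g$ in $\kappa(v_i,v_j)$ is nonzero. Color Lie rings. Let $A$ be an abelian group (written multiplicatively). A bicharacter is a map $\epsilon:A\times A\to\mathbb{K}^*$ with $\epsilon(a,bc)=\epsilon(a,b)\epsilon(a,c)$, $\epsilon(ab,c)=\epsilon(a,c)\epsilon(b,c)$; it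 is antisymmetric if $\epsilon(b,a)=\epsilon(a,b)^{-1}$. Let $R$ be an $A$-graded $\mathbb{K}$-algebra; an $A$-graded $R$-bimodule is an $R$-bimodule $L=\bigoplus_{a\in A}L_a$ with $R_aL_bR_c\subset L_{abc}$. For $0\ne x$ in the degree-$a$ part write $|x|=a$ ($x$ is $A$-homogeneous); $|0|=1_A$. An ungraded $(A,\epsilon)$-color Lie ring over $R$ is an $A$-graded $R$-bimodule $L$ with an $R$-bilinear, $R$-balanced operation $[\,,\,]:L\times L\to L$ (i.e. $\mathbb{K}$-bilinear with $[rx,ys]=r[x,y]s$ and $[xr,y]=[x,ry]$ for $r,s\in R$) such that for all $A$-homogeneous $x,y,z$: $[x,y]=-\epsilon(|x|,|y|)[y,x]$ and $\epsilon(|z|,|x|)[x,[y,z]]+\epsilon(|x|,|y|)[y,[z,x]]+\epsilon(|y|,|z|)[z,[x,y]]=0$ (the condition $[x,y]\in L_{|x||y|}$ is not required). Its universal enveloping algebra is $\mathcal{U}(L)=T_R(L)/J$, where $T_R(L)=\bigoplus_{m\ge0}L^{\otimes_Rm}$ and $J$ is the ideal generated by all $u\otimes_Rv-\epsilon(|u|,|v|)\,v\otimes_Ru-[u,v]$ with $u,v\in L$ $A$-homogeneous. The space $L=V\otimes\mathbb{K}G$ is a $\mathbb{K}G$-bimodule via $g(v\otimes h)g'={}^gv\otimes ghg'$. An ungraded color Lie ring structure on it over $\mathbb{K}G$ is Yetter-Drinfeld if the $A$-grading on $L$ is induced from $A$-gradings on $V$ and $G$ (each $g\in G$ homogeneous,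 $|v\otimes g|=|v||g|$ for homogeneous $v\in V$) and ${}^gv=\epsilon(|g|,|v|)\,v$ for all $g\in G$ and $A$-homogeneous $v\in V$. *)

(* Defs.v *)
From HB Require Import structures.
From mathcomp Require Import all_boot all_order all_fingroup all_algebra.
From mathcomp Require Import finmap generic_quotient boolp monalg.

Set Implicit Arguments.
Unset Strict Implicit.
Unset Printing Implicit Defensive.

Import GRing.Theory.
Local Open Scope ring_scope.
Local Open Scope quotient_scope.

Inductive span (K : pzRingType) (M : lmodType K) (S : M -> Prop) : M -> Prop :=
| span0 : span S 0
| span_gen x of S x : span S x
| span_lin c x y of span S x & span S y : span S (c *: x + y).

Section Span.
Variables (K : pzRingType) (M : lmodType K) (S : M -> Prop).

Lemma spanD x y : span S x -> span S y -> span S (x + y).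
Proof. by move=> Sx Sy; rewrite -[x]scale1r; apply: span_lin. Qed.

Lemma spanZ c x : span S x -> span S (c *: x).
Proof. by move=> Sx; rewrite -[_ *: _]addr0; apply: span_lin => //; apply: span0. Qed.

Lemma spanN x : span S x -> span S (- x).
Proof. by rewrite -scaleN1r; apply: spanZ. Qed.

Lemma spanB x y : span S x -> span S y -> span S (x - y).
Proof. by move=> Sx /spanN; apply: spanD. Qed.

Definition span_pred : {pred M} := fun x => `[<span S x>].

Lemma span_zmod_closed : zmod_closed span_pred.
Proof.
split=> [|x y /asboolP Sx /asboolP Sy]; apply/asboolP; first exact: span0.
exact: spanB.
Qed.
HB.instance Definition _ := GRing.isZmodClosed.Build M span_pred span_zmod_closed.

Definition quot_mod := Quotient.quot span_pred.
HB.instance Definition _ := EqQuotient.on quot_mod.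
HB.instance Definition _ := GRing.Zmodule.on quot_mod.

Definition qpi (x : M) : quot_mod := \pi_quot_mod x.

Lemma qpiP x y : qpi x = qpi y <-> span S (x - y).
Proof.
split; first by move=> /eqP; rewrite -Quotient.idealrBE => /asboolP.
by move=> Sxy; apply/eqP; rewrite -Quotient.idealrBE; apply/asboolP.
Qed.

Lemma qpi_repr (x : quot_mod) : qpi (repr x) = x.
Proof. exact: reprK. Qed.

Lemma repr_qpi x : span S (repr (qpi x) - x).
Proof. by apply/qpiP; rewrite qpi_repr. Qed.

Lemma qpiD : {morph qpi : x y / x + y}.
Proof. by move=> x y; rewrite /qpi !piE. Qed.

Definition qscale c (x : quot_mod) := qpi (c *: repr x).

Lemma qscaleE c x : qscale c (qpi x) = qpi (c *: x).
Proof. by apply/qpiP; rewrite -scalerBr; apply/spanZ/repr_qpi. Qed.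

Fact qscaleA a b x : qscale a (qscale b x) = qscale (a * b) x.
Proof. by rewrite -[x]qpi_repr !qscaleE scalerA. Qed.
Fact qscale1 : left_id 1 qscale.
Proof. by move=> x; rewrite -[x]qpi_repr qscaleE scale1r. Qed.
Fact qscaleDr : right_distributive qscale +%R.
Proof.
by move=> a x y; rewrite -[x]qpi_repr -[y]qpi_repr -qpiD !qscaleE scalerDr qpiD.
Qed.
Fact qscaleDl x : {morph qscale^~ x : a b / a + b}.
Proof.
by move=> a b /=; rewrite -[x]qpi_repr !qscaleE scalerDl qpiD.
Qed.
HB.instance Definition _ := GRing.Zmodule_isLmodule.Build K quot_mod
  qscaleA qscale1 qscaleDr qscaleDl.

Fact qpi_linear : linear qpi.
Proof. by move=> c x y; rewrite qpiD -qscaleE. Qed.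
HB.instance Definition _ := GRing.isLinear.Build K M quot_mod *:%R qpi qpi_linear.

Lemma qpi_gen x : S x -> qpi x = 0.
Proof.
by move=> Sx; rewrite -(raddf0 qpi); apply/qpiP; rewrite subr0; apply: span_gen.
Qed.

End Span.

Definition is_basis (K : pzRingType) (M : lmodType K) (I : eqType) (b : I -> M) :=
  (forall (s : seq I) (c : I -> K), uniq s ->
     \sum_(i <- s) c i *: b i = 0 -> {in s, forall i, c i = 0}) /\
  (forall x : M, exists (s : seq I) (c : I -> K), x = \sum_(i <- s) c i *: b i).

(* The quotient may be zero, while [lalgType] requires 1 != 0; it is therefore
   a [pzRingType] and an [lmodType], with the compatibility proved as
   [quot_scalerAl] and [quot_scalerAr]. *)
Section QuotAlg.
Variables (K : comNzRingType) (B : algType K) (S : B -> Prop).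

Definition ideal_gens (x : B) : Prop :=
  exists a s b, S s /\ x = a * s * b.

Definition quot_alg := quot_mod ideal_gens.
HB.instance Definition _ := GRing.Lmodule.on quot_alg.

Local Notation pi := (qpi ideal_gens).

Lemma idealMl a x : span ideal_gens x -> span ideal_gens (a * x).
Proof.
elim=> [|y [b [s [c [Ss ->]]]]|c y z _ Sy _ Sz].
- by rewrite mulr0; apply: span0.
- by apply: span_gen; exists (a * b), s, c; rewrite !mulrA.
- by rewrite mulrDr -scalerAr; apply: span_lin.
Qed.

Lemma idealMr a x : span ideal_gens x -> span ideal_gens (x * a).
Proof.
elim=> [|y [b [s [c [Ss ->]]]]|c y z _ Sy _ Sz].
- by rewrite mul0r; apply: span0.
- by apply: span_gen; exists b, s, (c * a); rewrite !mulrA.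
- by rewrite mulrDl -scalerAl; apply: span_lin.
Qed.

Definition quot_one : quot_alg := pi 1.
Definition quot_mul (x y : quot_alg) : quot_alg := pi (repr x * repr y).

Lemma quot_mulE x y : quot_mul (pi x) (pi y) = pi (x * y).
Proof.
apply/qpiP; set x' := repr _; set y' := repr _.
have -> : x' * y' - x * y = (x' - x) * y' + x * (y' - y).
  by rewrite mulrBl mulrBr addrA subrK.
by apply: spanD; [apply/idealMr/repr_qpi | apply/idealMl/repr_qpi].
Qed.

Fact quot_mulA : associative quot_mul.
Proof.
move=> x y z; rewrite -[x]qpi_repr -[y]qpi_repr -[z]qpi_repr.
by rewrite !quot_mulE mulrA.
Qed.
Fact quot_mul1 : left_id quot_one quot_mul.
Proof. by move=> x; rewrite -[x]qpi_repr quot_mulE mul1r. Qed.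
Fact quot_mulr1 : right_id quot_one quot_mul.
Proof. by move=> x; rewrite -[x]qpi_repr quot_mulE mulr1. Qed.
Fact quot_mulDl : left_distributive quot_mul +%R.
Proof.
move=> x y z; rewrite -[x]qpi_repr -[y]qpi_repr -[z]qpi_repr.
by rewrite -raddfD !quot_mulE mulrDl raddfD.
Qed.
Fact quot_mulDr : right_distributive quot_mul +%R.
Proof.
move=> x y z; rewrite -[x]qpi_repr -[y]qpi_repr -[z]qpi_repr.
by rewrite -raddfD !quot_mulE mulrDr raddfD.
Qed.
HB.instance Definition _ := GRing.Zmodule_isPzRing.Build quot_alg
  quot_mulA quot_mul1 quot_mulr1 quot_mulDl quot_mulDr.

Definition quot_pi (x : B) : quot_alg := pi x.

Lemma quot_piM : {morph quot_pi : x y / x * y}.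
Proof. by move=> x y; rewrite /quot_pi -quot_mulE. Qed.

Fact quot_pi_linear : linear quot_pi.
Proof. exact: qpi_linear. Qed.
HB.instance Definition _ :=
  GRing.isLinear.Build K B quot_alg *:%R quot_pi quot_pi_linear.
Fact quot_pi_monoid : monoid_morphism quot_pi.
Proof. by split=> // x y; rewrite quot_piM. Qed.
HB.instance Definition _ :=
  GRing.isMonoidMorphism.Build B quot_alg quot_pi quot_pi_monoid.

Lemma quot_scalerAl c (x y : quot_alg) : c *: (x * y) = (c *: x) * y.
Proof.
rewrite -[x]qpi_repr -[y]qpi_repr -!/(quot_pi _).
by rewrite -quot_piM -!linearZ -quot_piM /= scalerAl.
Qed.

Lemma quot_scalerAr c (x y : quot_alg) : c *: (x * y) = x * (c *: y).
Proof.
rewrite -[x]qpi_repr -[y]qpi_repr -!/(quot_pi _).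
by rewrite -quot_piM -!linearZ -quot_piM /= scalerAr.
Qed.

End QuotAlg.

Section LinearFacts.
Variable K : pzRingType.

Lemma lin0 (N N' : lmodType K) (f : N -> N') : linear f -> f 0 = 0.
Proof.
by move=> f_lin; have := f_lin (-1) 0 0; rewrite scaleN1r oppr0 addr0 => ->;
  rewrite scaleN1r addNr.
Qed.

Lemma linD (N N' : lmodType K) (f : N -> N') : linear f -> {morph f : x y / x + y}.
Proof. by move=> fl x y; have := fl 1 x y; rewrite !scale1r. Qed.

Lemma linZ (N N' : lmodType K) (f : N -> N') :
  linear f -> forall c, {morph f : x / c *: x}.
Proof. by move=> fl c x; have := fl c x 0; rewrite (lin0 fl) !addr0. Qed.

Lemma comp_lin (N1 N2 N3 : lmodType K) (f : N2 -> N3) (g : N1 -> N2) :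
  linear f -> linear g -> linear (fun x => f (g x)).
Proof. by move=> fl gl c x y; rewrite gl fl. Qed.

Lemma id_lin (N : lmodType K) : linear (fun x : N => x).
Proof. by []. Qed.

End LinearFacts.

Lemma lin_swap (K : comPzRingType) (N : lmodType K) (d c : K) (a b a' b' : N) :
  d *: (c *: a + b) + (c *: a' + b') = c *: (d *: a + a') + (d *: b + b').
Proof. by rewrite !scalerDr !scalerA [d * c]mulrC addrACA. Qed.

(* The product of the direct sum of R and Q, for a nonunital algebra Q in R-bimodules *)
Section Unitization.
Variables (K : comNzRingType) (R : algType K) (Q : lmodType K).
Variables (tl : R -> Q -> Q) (tr : Q -> R -> Q) (tm : Q -> Q -> Q).
Hypotheses (tl_linr : forall r, linear (tl r)) (tl_linl : forall p, linear (tl^~ p)).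
Hypotheses (tr_linl : forall r, linear (tr^~ r)) (tr_linr : forall p, linear (tr p)).
Hypotheses (tm_linl : forall q, linear (tm^~ q)) (tm_linr : forall p, linear (tm p)).
Hypotheses (tl1 : forall p, tl 1 p = p) (tr1 : forall p, tr p 1 = p).
Hypotheses (tlM : forall r s p, tl (r * s) p = tl r (tl s p))
  (trM : forall r s p, tr p (r * s) = tr (tr p r) s)
  (tlr : forall r p s, tl r (tr p s) = tr (tl r p) s)
  (tlm : forall r p q, tl r (tm p q) = tm (tl r p) q)
  (tmr : forall p q r, tr (tm p q) r = tm p (tr q r))
  (tmb : forall p r q, tm (tr p r) q = tm p (tl r q))
  (tmA : forall p q s, tm p (tm q s) = tm (tm p q) s).

Definition unit_mul (a b : R * Q) : R * Q :=
  (a.1 * b.1, tl a.1 b.2 + tr a.2 b.1 + tm a.2 b.2).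

Let tlDr r := linD (tl_linr r).
Let tlDl p := linD (tl_linl p).
Let trDr p := linD (tr_linr p).
Let trDl r := linD (tr_linl r).
Let tmDr p := linD (tm_linr p).
Let tmDl q := linD (tm_linl q).

Lemma unit_mulA : associative unit_mul.
Proof.
move=> [a p] [b q] [c s]; rewrite /unit_mul /= mulrA; apply: (congr2 pair) => //.
rewrite !tlDr !trDl !tmDr !tmDl tlM trM tlr tlm tmr tmA tmb.
rewrite -!addrA; congr (_ + _); congr (_ + _).
rewrite [LHS]addrCA; congr (_ + _); rewrite [RHS]addrCA; congr (_ + _).
by rewrite addrCA.
Qed.

Lemma unit_mul1 : left_id (1, 0) unit_mul.
Proof.
move=> [a p]; rewrite /unit_mul /= mul1r tl1 (lin0 (tr_linl a)).
by rewrite (lin0 (tm_linl p)) !addr0.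
Qed.

Lemma unit_mulr1 : right_id (1, 0) unit_mul.
Proof.
move=> [a p]; rewrite /unit_mul /= mulr1 tr1 (lin0 (tl_linr a)).
by rewrite (lin0 (tm_linr p)) add0r addr0.
Qed.

Lemma unit_mulDl : left_distributive unit_mul +%R.
Proof.
move=> [a p] [b q] [c s]; rewrite /unit_mul /= mulrDl; apply: (congr2 pair) => //=.
rewrite tlDl trDl tmDl [RHS]addrACA; congr (_ + _).
by rewrite addrACA.
Qed.

Lemma unit_mulDr : right_distributive unit_mul +%R.
Proof.
move=> [a p] [b q] [c s]; rewrite /unit_mul /= mulrDr; apply: (congr2 pair) => //=.
rewrite tlDr trDr tmDr [RHS]addrACA; congr (_ + _).
by rewrite addrACA.
Qed.

Lemma unit_scalerAl k a b : k *: unit_mul a b = unit_mul (k *: a) b.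
Proof.
case: a b => [a p] [b q]; rewrite /unit_mul; apply: (congr2 pair) => /=.
  by rewrite scalerAl.
rewrite (linZ (tl_linl _)) (linZ (tr_linl _)) (linZ (tm_linl _)).
by rewrite !scalerDr.
Qed.

Lemma unit_scalerAr k a b : k *: unit_mul a b = unit_mul a (k *: b).
Proof.
case: a b => [a p] [b q]; rewrite /unit_mul; apply: (congr2 pair) => /=.
  by rewrite scalerAr.
rewrite (linZ (tl_linr _)) (linZ (tr_linr _)) (linZ (tm_linr _)).
by rewrite !scalerDr.
Qed.

Variables (C : algType K) (f : R -> C) (g : Q -> C).
Hypotheses (f_lin : linear f) (f1 : f 1 = 1) (fM : {morph f : r s / r * s}).
Hypotheses (g_lin : linear g) (gl : forall r p, g (tl r p) = f r * g p)
  (gr : forall p r, g (tr p r) = g p * f r) (gm : forall p q, g (tm p q) = g p * g q).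

Lemma unit_liftM (a b : R * Q) :
  f (unit_mul a b).1 + g (unit_mul a b).2 = (f a.1 + g a.2) * (f b.1 + g b.2).
Proof.
rewrite /= fM !(linD g_lin) gl gr gm mulrDl !mulrDr.
by rewrite -!addrA.
Qed.
End Unitization.

Record bimodule (K : comNzRingType) (R : algType K) (L : lmodType K) := Bimodule {
  lact : R -> L -> L;
  ract : L -> R -> L;
  lact_linl : forall x, linear (lact^~ x);
  lact_linr : forall r, linear (lact r);
  ract_linl : forall r, linear (ract^~ r);
  ract_linr : forall x, linear (ract x);
  lact1 : forall x, lact 1 x = x;
  lactM : forall r s x, lact (r * s) x = lact r (lact s x);
  ract1 : forall x, ract x 1 = x;
  ractM : forall r s x, ract x (r * s) = ract (ract x r) s;
  lractA : forall r x s, lact r (ract x s) = ract (lact r x) s }.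

Definition wmk (L : Type) (u : seq L) (x : L) (v : seq L) : L * seq L :=
  if u is y :: u' then (y, u' ++ x :: v) else (x, v).

Section FreeModule.
Variables (K : comNzRingType) (W : choiceType) (N : lmodType K) (h : W -> N).

Definition free_lift (p : {malg K[W]}) : N := \sum_(k <- msupp p) p@_k *: h k.

Lemma free_liftEw (d : {fset W}) p : (msupp p `<=` d)%fset ->
  free_lift p = \sum_(k <- d) p@_k *: h k.
Proof.
move=> le; rewrite /free_lift.
rewrite -(big_fset_incl _ le) //= => k _ /mcoeff_outdom ->.
by rewrite scale0r.
Qed.

Fact free_lift_linear : linear free_lift.
Proof.
move=> c p q; pose d := (msupp p `|` msupp q `|` msupp (c *: p + q))%fset.
rewrite (@free_liftEw d p); last by rewrite /d -fsetUA fsubsetUl.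
rewrite (@free_liftEw d q); last by rewrite /d fsetUAC fsubsetUr.
rewrite (@free_liftEw d); last by rewrite /d fsubsetUr.
rewrite scaler_sumr -big_split /=; apply: eq_bigr => k _.
by rewrite mcoeffD mcoeffZ scalerDl scalerA.
Qed.
HB.instance Definition _ :=
  GRing.isLinear.Build K {malg K[W]} N *:%R free_lift free_lift_linear.

Lemma free_liftU k : free_lift << k >> = h k.
Proof.
by rewrite (@free_liftEw [fset k]%fset) ?msuppU_le // big_seq_fset1 mcoeffUU scale1r.
Qed.

Lemma free_ind (P : {malg K[W]} -> Prop) :
  P 0 -> (forall c p q, P p -> P q -> P (c *: p + q)) ->
  (forall k, P << k >>) -> forall p, P p.
Proof.
move=> P0 PD PU p; rewrite [p]monalgE.
elim/big_ind: _ => // [x y Px Py|k _].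
  by rewrite -[x]scale1r; apply: PD.
rewrite -[<< _ *g k >>]addr0.
have -> : << p@_k *g k >> = p@_k *: << k >> :> {malg K[W]}.
  by apply/malgP=> k'; rewrite mcoeffZ !mcoeffU mulr_natr.
exact: PD.
Qed.

End FreeModule.

(* [tensor_alg] is the direct sum over m >= 0 of the m-fold tensor powers of L
   over R.  The summand m = 0 is R; [tpos] is the sum over m >= 1: the free
   K-module on the nonempty words x_1 ... x_m in L, a word (x, s) having first
   letter x, modulo K-multilinearity and the balancing relations
   (.. x r) (y ..) = (.. x) (r y ..).  These relations are homogeneous in the
   length m, so the quotient is graded by m. *)
Section TensorAlgebra.
Variables (K : comNzRingType) (R : algType K) (L : lmodType K).
Variable (B : bimodule R L).

Local Notation word := (L * seq L)%type.
Local Notation lact := (lact B).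
Local Notation ract := (ract B).

Implicit Types (u v : seq L) (x y : L).

Inductive tens_rel : {malg K[word]} -> Prop :=
| tens_lin u c x y v :
    tens_rel (<< wmk u (c *: x + y) v >>
              - (c *: << wmk u x v >> + << wmk u y v >>))
| tens_bal u x r y v :
    tens_rel (<< wmk u (ract x r) (y :: v) >>
              - << wmk u x (lact r y :: v) >>).

Definition tpos := quot_mod tens_rel.
HB.instance Definition _ := GRing.Lmodule.on tpos.

Definition tw (w : word) : tpos := qpi tens_rel << w >>.

Lemma tw_lin u c x y v :
  tw (wmk u (c *: x + y) v) = c *: tw (wmk u x v) + tw (wmk u y v).
Proof.
apply/eqP; rewrite -subr_eq0 -linearP -raddfB; apply/eqP.
exact/qpi_gen/tens_lin.
Qed.

Lemma tw_bal u x r y v :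
  tw (wmk u (ract x r) (y :: v)) = tw (wmk u x (lact r y :: v)).
Proof.
apply/eqP; rewrite -subr_eq0 -raddfB; apply/eqP.
exact/qpi_gen/tens_bal.
Qed.

Lemma tpos_ind (P : tpos -> Prop) :
  P 0 -> (forall c p q, P p -> P q -> P (c *: p + q)) ->
  (forall w, P (tw w)) -> forall p, P p.
Proof.
move=> P0 PD Pw p; rewrite -[p]qpi_repr; move: (repr p).
apply: free_ind => [|c {}p q Pp Pq|k]; first by rewrite raddf0.
  by rewrite linearP; apply: PD.
exact: Pw.
Qed.

Section Lift.
Variables (N : lmodType K) (h : word -> N).
Definition tpos_lift (p : tpos) : N := free_lift h (repr p).

Hypothesis h_lin : forall u c x y v,
  h (wmk u (c *: x + y) v) = c *: h (wmk u x v) + h (wmk u y v).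
Hypothesis h_bal : forall u x r y v,
  h (wmk u (ract x r) (y :: v)) = h (wmk u x (lact r y :: v)).

Lemma free_lift_rel p : span tens_rel p -> free_lift h p = 0.
Proof.
elim=> [|_ [u c x y v|u x r y v]|c x y _ IHx _ IHy]; first exact: raddf0.
- by rewrite raddfB /= linearP /= !free_liftU h_lin subrr.
- by rewrite raddfB /= !free_liftU h_bal subrr.
- by rewrite linearP /= IHx IHy scaler0 addr0.
Qed.

Lemma tpos_lift_pi p : tpos_lift (qpi tens_rel p) = free_lift h p.
Proof.
apply/eqP; rewrite -subr_eq0 /tpos_lift -raddfB; apply/eqP.
exact/free_lift_rel/repr_qpi.
Qed.

Lemma tpos_liftE w : tpos_lift (tw w) = h w.
Proof. by rewrite tpos_lift_pi free_liftU. Qed.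

Lemma tpos_lift_linear : linear tpos_lift.
Proof.
move=> c p q; rewrite -[p]qpi_repr -[q]qpi_repr.
by rewrite -linearP !tpos_lift_pi linearP.
Qed.
End Lift.

Definition wseq (w : word) : seq L := w.1 :: w.2.
Definition wl (r : R) (w : word) : word := (lact r w.1, w.2).
Definition wr (w : word) (r : R) : word :=
  wmk (belast w.1 w.2) (ract (last w.1 w.2) r) [::].
Definition wcat (a b : word) : word := (a.1, a.2 ++ wseq b).

Lemma wseq_inj : injective wseq.
Proof. by case=> x s [y t] [-> ->]. Qed.

Lemma wseq_mk u x v : wseq (wmk u x v) = u ++ x :: v.
Proof. by case: u. Qed.

Lemma wseq_cat a b : wseq (wcat a b) = wseq a ++ wseq b.
Proof. by []. Qed.

Lemma word_last w : exists u x, w = wmk u x [::].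
Proof.
exists (belast w.1 w.2), (last w.1 w.2); apply: wseq_inj.
by rewrite wseq_mk cats1 -lastI.
Qed.

Lemma wr_mk u x r : wr (wmk u x [::]) r = wmk u (ract x r) [::].
Proof.
apply: wseq_inj; rewrite !wseq_mk !cats1.
have := wseq_mk u x [::]; rewrite cats1 /wseq lastI => /rcons_inj[-> ->].
by [].
Qed.

Lemma wr_mk_rcons u x v y r :
  wr (wmk u x (rcons v y)) r = wmk u x (rcons v (ract y r)).
Proof.
have E z : wmk u x (rcons v z) = wmk (u ++ x :: v) z [::].
  by apply: wseq_inj; rewrite !wseq_mk cats1 rcons_cat.
by rewrite !E wr_mk.
Qed.

Lemma wcat_mkl u x v b : wcat (wmk u x v) b = wmk u x (v ++ wseq b).
Proof. by apply: wseq_inj; rewrite wseq_cat !wseq_mk -catA. Qed.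

Lemma wcat_mkr a u x v : wcat a (wmk u x v) = wmk (wseq a ++ u) x v.
Proof. by apply: wseq_inj; rewrite wseq_cat !wseq_mk -catA. Qed.

Definition tl (r : R) : tpos -> tpos := tpos_lift (fun w => tw (wl r w)).
Definition tr (p : tpos) (r : R) : tpos := tpos_lift (fun w => tw (wr w r)) p.
Definition tm (p q : tpos) : tpos :=
  tpos_lift (fun a => tpos_lift (fun b => tw (wcat a b)) q) p.

Fact tl_h_lin r u c x y v :
  tw (wl r (wmk u (c *: x + y) v))
    = c *: tw (wl r (wmk u x v)) + tw (wl r (wmk u y v)).
Proof.
case: u => [|z u]; last exact: (tw_lin (lact r z :: u)).
by rewrite /wl /= lact_linr; apply: (tw_lin [::]).
Qed.
Fact tl_h_bal r u x s y v :
  tw (wl r (wmk u (ract x s) (y :: v))) = tw (wl r (wmk u x (lact s y :: v))).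
Proof.
case: u => [|z u]; last exact: (tw_bal (lact r z :: u)).
by rewrite /wl /= lractA; apply: (tw_bal [::]).
Qed.
Fact tr_h_lin r u c x y v :
  tw (wr (wmk u (c *: x + y) v) r)
    = c *: tw (wr (wmk u x v) r) + tw (wr (wmk u y v) r).
Proof.
case/lastP: v => [|v z]; last by rewrite !wr_mk_rcons tw_lin.
by rewrite !wr_mk ract_linl tw_lin.
Qed.
Fact tr_h_bal r u x s y v :
  tw (wr (wmk u (ract x s) (y :: v)) r) = tw (wr (wmk u x (lact s y :: v)) r).
Proof.
case/lastP: v => [|v z].
  by rewrite !(wr_mk_rcons _ _ [::]) /= -lractA tw_bal.
by rewrite -!rcons_cons !wr_mk_rcons tw_bal.
Qed.
Fact tm_h_linr a u c x y v :
  tw (wcat a (wmk u (c *: x + y) v))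
    = c *: tw (wcat a (wmk u x v)) + tw (wcat a (wmk u y v)).
Proof. by rewrite !wcat_mkr tw_lin. Qed.
Fact tm_h_balr a u x s y v :
  tw (wcat a (wmk u (ract x s) (y :: v))) = tw (wcat a (wmk u x (lact s y :: v))).
Proof. by rewrite !wcat_mkr tw_bal. Qed.

Lemma tlE r w : tl r (tw w) = tw (wl r w).
Proof. exact: tpos_liftE (tl_h_lin r) (tl_h_bal r) w. Qed.
Lemma tl_linr r : linear (tl r).
Proof. exact: tpos_lift_linear (tl_h_lin r) (tl_h_bal r). Qed.
Lemma trE w r : tr (tw w) r = tw (wr w r).
Proof. exact: tpos_liftE (tr_h_lin r) (tr_h_bal r) w. Qed.
Lemma tr_linl r : linear (tr^~ r).
Proof. exact: tpos_lift_linear (tr_h_lin r) (tr_h_bal r). Qed.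

Local Notation tcat a := (tpos_lift (fun b => tw (wcat a b))).
Fact tcatE a b : tcat a (tw b) = tw (wcat a b).
Proof. exact: tpos_liftE (tm_h_linr a) (tm_h_balr a) b. Qed.
Fact tcat_lin a : linear (tcat a).
Proof. exact: tpos_lift_linear (tm_h_linr a) (tm_h_balr a). Qed.
Fact tcat0 a : tcat a 0 = 0.
Proof. exact: lin0 (tcat_lin a). Qed.

Fact tm_h_linl q u c x y v :
  tcat (wmk u (c *: x + y) v) q = c *: tcat (wmk u x v) q + tcat (wmk u y v) q.
Proof.
elim/tpos_ind: q => [|d p q IHp IHq|w]; first by rewrite !tcat0 scaler0 addr0.
  rewrite !(tcat_lin _ d p q) IHp IHq; exact: lin_swap.
by rewrite !tcatE !wcat_mkl tw_lin.
Qed.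
Fact tm_h_ball q u x s y v :
  tcat (wmk u (ract x s) (y :: v)) q = tcat (wmk u x (lact s y :: v)) q.
Proof.
elim/tpos_ind: q => [|d p q IHp IHq|w]; first by rewrite !tcat0.
  by rewrite !(tcat_lin _ d p q) IHp IHq.
by rewrite !tcatE !wcat_mkl tw_bal.
Qed.

Lemma tm_linl q : linear (tm^~ q).
Proof. exact: tpos_lift_linear (tm_h_linl q) (tm_h_ball q). Qed.
Lemma tmEl a q : tm (tw a) q = tcat a q.
Proof. exact: tpos_liftE (tm_h_linl q) (tm_h_ball q) a. Qed.
Lemma tmE a b : tm (tw a) (tw b) = tw (wcat a b).
Proof. by rewrite tmEl tcatE. Qed.

Lemma tm_linr p : linear (tm p).
Proof.
move=> c q q'; elim/tpos_ind: p => [|d p p' IHp IHp'|a].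
- by rewrite !(lin0 (tm_linl _)) scaler0 addr0.
- rewrite !(tm_linl _ d p p') IHp IHp'; exact: lin_swap.
- by rewrite !tmEl (tcat_lin a c q q').
Qed.

Lemma tl_linl p : linear (tl^~ p).
Proof.
move=> c r s; elim/tpos_ind: p => [|d p p' IHp IHp'|a] /=.
- by rewrite !(lin0 (tl_linr _)) scaler0 addr0.
- rewrite /= in IHp IHp'; rewrite !(tl_linr _ d p p') IHp IHp'; exact: lin_swap.
- by rewrite !tlE /wl lact_linl; apply: (tw_lin [::]).
Qed.

Lemma tr_linr p : linear (tr p).
Proof.
move=> c r s; elim/tpos_ind: p => [|d p p' IHp IHp'|a] /=.
- by rewrite !(lin0 (tr_linl _)) scaler0 addr0.
- rewrite !(tr_linl _ d p p') IHp IHp'; exact: lin_swap.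
- by rewrite !trE; have [u [x ->]] := word_last a; rewrite !wr_mk ract_linr tw_lin.
Qed.

Lemma tpos_ext2 (N : lmodType K) (f g : tpos -> N) :
  linear f -> linear g -> (forall w, f (tw w) = g (tw w)) -> f =1 g.
Proof.
move=> fl gl fg; elim/tpos_ind=> [|c p q IHp IHq|//]; first by rewrite !lin0.
by rewrite (fl c p q) (gl c p q) IHp IHq.
Qed.

Lemma tpos_ext (f g : tpos -> tpos) :
  linear f -> linear g -> (forall w, f (tw w) = g (tw w)) -> f =1 g.
Proof. exact: tpos_ext2. Qed.

Lemma tl1 p : tl 1 p = p.
Proof.
apply: (tpos_ext (tl_linr 1) (id_lin (N := tpos))) p => -[x s].
by rewrite tlE /wl lact1.
Qed.

Lemma tlM r s p : tl (r * s) p = tl r (tl s p).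
Proof.
apply: (tpos_ext (tl_linr _) (comp_lin (tl_linr r) (tl_linr s))) p => -[x u].
by rewrite !tlE /wl lactM.
Qed.

Lemma tr1 p : tr p 1 = p.
Proof.
apply: (tpos_ext (tr_linl 1) (id_lin (N := tpos))) p => w.
by have [u [x ->]] := word_last w; rewrite trE wr_mk ract1.
Qed.

Lemma trM r s p : tr p (r * s) = tr (tr p r) s.
Proof.
apply: (tpos_ext (tr_linl _) (comp_lin (tr_linl s) (tr_linl r))) p => w.
by have [u [x ->]] := word_last w; rewrite !(trE, wr_mk) ractM.
Qed.

Lemma tlr r p s : tl r (tr p s) = tr (tl r p) s.
Proof.
apply: (tpos_ext (comp_lin (tl_linr r) (tr_linl s))
                 (comp_lin (tr_linl s) (tl_linr r))) p => w.
have [u [x ->]] := word_last w; rewrite !(tlE, trE) wr_mk.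
case: u => [|y u]; first by rewrite /wl /= lractA.
by rewrite [wl r (wmk _ x _)](_ : _ = wmk (lact r y :: u) x [::]) // wr_mk.
Qed.

Lemma tlm r p q : tl r (tm p q) = tm (tl r p) q.
Proof.
apply: (tpos_ext (comp_lin (tl_linr r) (tm_linl q))
                 (comp_lin (tm_linl q) (tl_linr r))) p => a /=.
rewrite tlE; apply: (tpos_ext (comp_lin (tl_linr r) (tm_linr (tw a)))
                              (tm_linr _)) q => b.
by rewrite !tmE tlE.
Qed.

Lemma tmr p q r : tr (tm p q) r = tm p (tr q r).
Proof.
apply: (tpos_ext (comp_lin (tr_linl r) (tm_linl q)) (tm_linl _)) p => a /=.
apply: (tpos_ext (comp_lin (tr_linl r) (tm_linr (tw a)))
                 (comp_lin (tm_linr (tw a)) (tr_linl r))) q => b.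
have [u [x ->]] := word_last b.
by rewrite !(trE, tmE, wcat_mkr, wr_mk).
Qed.

Lemma tmb p r q : tm (tr p r) q = tm p (tl r q).
Proof.
apply: (tpos_ext (comp_lin (tm_linl q) (tr_linl r)) (tm_linl _)) p => a /=.
rewrite trE; apply: (tpos_ext (tm_linr _)
                 (comp_lin (tm_linr (tw a)) (tl_linr r))) q => b.
have [u [x ->]] := word_last a.
by rewrite tlE !tmE wr_mk !wcat_mkl /= tw_bal.
Qed.

Lemma tmA p q s : tm p (tm q s) = tm (tm p q) s.
Proof.
apply: (tpos_ext (tm_linl _) (comp_lin (tm_linl s) (tm_linl q))) p => a /=.
apply: (tpos_ext (comp_lin (tm_linr _) (tm_linl s))
                 (comp_lin (tm_linl s) (tm_linr _))) q => b /=.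
apply: (tpos_ext (comp_lin (tm_linr _) (tm_linr _)) (tm_linr _)) s => c.
by rewrite !tmE; congr tw; apply: wseq_inj; rewrite !wseq_cat catA.
Qed.

Definition tensor_alg := (R * tpos)%type.
HB.instance Definition _ := GRing.Lmodule.on tensor_alg.

Definition tens_one : tensor_alg := (1, 0).
Definition tens_mul : tensor_alg -> tensor_alg -> tensor_alg := unit_mul tl tr tm.

Fact tens_mulA : associative tens_mul.
Proof.
exact: unit_mulA tl_linr tr_linl tm_linl tm_linr tlM trM tlr tlm tmr tmb tmA.
Qed.
Fact tens_mul1 : left_id tens_one tens_mul.
Proof. exact: unit_mul1 tr_linl tm_linl tl1. Qed.
Fact tens_mulr1 : right_id tens_one tens_mul.
Proof. exact: unit_mulr1 tl_linr tm_linr tr1. Qed.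
Fact tens_mulDl : left_distributive tens_mul +%R.
Proof. exact: unit_mulDl tl_linl tr_linl tm_linl. Qed.
Fact tens_mulDr : right_distributive tens_mul +%R.
Proof. exact: unit_mulDr tl_linr tr_linr tm_linr. Qed.
Fact tens_one_neq0 : tens_one != 0.
Proof. by apply/eqP => -[/eqP]; rewrite oner_eq0. Qed.
HB.instance Definition _ := GRing.Zmodule_isNzRing.Build tensor_alg
  tens_mulA tens_mul1 tens_mulr1 tens_mulDl tens_mulDr tens_one_neq0.
Fact tens_scalerAl (k : K) (a b : tensor_alg) : k *: (a * b) = (k *: a) * b.
Proof. exact: unit_scalerAl tl_linl tr_linl tm_linl k a b. Qed.
HB.instance Definition _ :=
  GRing.Lmodule_isLalgebra.Build K tensor_alg tens_scalerAl.
Fact tens_scalerAr (k : K) (a b : tensor_alg) : k *: (a * b) = a * (k *: b).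
Proof. exact: unit_scalerAr tl_linr tr_linr tm_linr k a b. Qed.
HB.instance Definition _ :=
  GRing.Lalgebra_isAlgebra.Build K tensor_alg tens_scalerAr.

Definition tens_scal (r : R) : tensor_alg := (r, 0).
Definition tens_in (x : L) : tensor_alg := (0, tw (x, [::])).

Lemma tens_scal_linear : linear tens_scal.
Proof.
by move=> c r s; apply: (congr2 pair) => //=; rewrite scaler0 addr0.
Qed.

Lemma tens_scalM : {morph tens_scal : r s / r * s}.
Proof.
move=> r s; apply: (congr2 pair) => //=.
by rewrite (lin0 (tl_linr _)) (lin0 (tr_linl _)) (lin0 (tm_linl _)) !addr0.
Qed.

Lemma tens_in_linear : linear tens_in.
Proof.
move=> c x y; apply: (congr2 pair) => /=; first by rewrite scaler0 addr0.
exact: (tw_lin [::] c x y [::]).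
Qed.

Lemma tens_in_lact r x : tens_in (lact r x) = tens_scal r * tens_in x.
Proof.
apply: (congr2 pair) => /=; first by rewrite mulr0.
by rewrite (lin0 (tr_linl _)) (lin0 (tm_linl _)) !addr0 tlE.
Qed.

Lemma tens_in_ract x r : tens_in (ract x r) = tens_in x * tens_scal r.
Proof.
apply: (congr2 pair) => /=; first by rewrite mul0r.
by rewrite (lin0 (tl_linr _)) (lin0 (tm_linr _)) add0r addr0 trE.
Qed.

Lemma tens_word w : (0, tw w) = \prod_(x <- wseq w) tens_in x :> tensor_alg.
Proof.
case: w => x s; rewrite /wseq /=; elim: s x => [|y s IH] x.
  by rewrite big_seq1.
rewrite big_cons -IH; apply: (congr2 pair) => /=; first by rewrite mul0r.
rewrite (lin0 (tr_linr _)) /= (lin0 (tl_linl _)) !add0r.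
by rewrite tmE.
Qed.

Lemma tens_ind (P : tensor_alg -> Prop) :
  (forall c a b, P a -> P b -> P (c *: a + b)) ->
  (forall r, P (tens_scal r)) ->
  (forall s, P (\prod_(x <- s) tens_in x)) -> forall a, P a.
Proof.
move=> PD Pr Pw [r p].
have -> : (r, p) = 1 *: tens_scal r + (0, p) :> tensor_alg.
  by rewrite scale1r; apply: (congr2 pair) => /=; rewrite ?addr0 ?add0r.
apply: (PD) => //; elim/tpos_ind: p => [|c p q Pp Pq|w].
- exact: Pr 0.
- have -> : (0, c *: p + q) = c *: (0, p) + (0, q) :> tensor_alg.
    by apply: (congr2 pair) => //=; rewrite scaler0 addr0.
  exact: PD.
- by rewrite tens_word.
Qed.

Section TensLift.
Variables (C : algType K) (f : R -> C) (phi : L -> C).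
Definition tens_lift (a : tensor_alg) : C :=
  f a.1 + tpos_lift (fun w => \prod_(x <- wseq w) phi x) a.2.

Hypotheses (f_lin : linear f) (f1 : f 1 = 1) (fM : {morph f : r s / r * s}).
Hypotheses (phi_lin : linear phi)
  (phil : forall r x, phi (lact r x) = f r * phi x)
  (phir : forall x r, phi (ract x r) = phi x * f r).

Local Notation h := (fun w => \prod_(x <- wseq w) phi x).

Fact tens_lift_h_lin u c x y v :
  h (wmk u (c *: x + y) v) = c *: h (wmk u x v) + h (wmk u y v).
Proof.
cbv beta; rewrite !wseq_mk !big_cat /= !big_cons phi_lin mulrDl mulrDr.
by rewrite -scalerAl -scalerAr.
Qed.

Fact tens_lift_h_bal u x r y v :
  h (wmk u (ract x r) (y :: v)) = h (wmk u x (lact r y :: v)).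
Proof. by cbv beta; rewrite !wseq_mk !big_cat /= !big_cons phil phir !mulrA. Qed.

Local Notation g := (tpos_lift h).
Fact tens_lift_gE w : g (tw w) = h w.
Proof. exact: tpos_liftE tens_lift_h_lin tens_lift_h_bal w. Qed.
Fact tens_lift_g_lin : linear g.
Proof. exact: tpos_lift_linear tens_lift_h_lin tens_lift_h_bal. Qed.

Lemma tens_liftr r : tens_lift (tens_scal r) = f r.
Proof. by rewrite /tens_lift /= (lin0 tens_lift_g_lin) addr0. Qed.

Lemma tens_lift_in x : tens_lift (tens_in x) = phi x.
Proof. by rewrite /tens_lift /= tens_lift_gE big_seq1 (lin0 f_lin) add0r. Qed.

Lemma tens_lift_linear : linear tens_lift.
Proof.
move=> c [r p] [s q]; rewrite /tens_lift /= f_lin tens_lift_g_lin scalerDr.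
by rewrite addrACA.
Qed.

Lemma tens_lift1 : tens_lift 1 = 1.
Proof. by rewrite tens_liftr. Qed.

Fact comp_lin_mull (N : lmodType K) (a : C) (k : N -> C) :
  linear k -> linear (fun p => a * k p).
Proof. by move=> kl c x y; rewrite kl mulrDr scalerAr. Qed.
Fact comp_lin_mulr (N : lmodType K) (a : C) (k : N -> C) :
  linear k -> linear (fun p => k p * a).
Proof. by move=> kl c x y; rewrite kl mulrDl scalerAl. Qed.

Lemma tens_liftM : {morph tens_lift : a b / a * b}.
Proof.
apply: unit_liftM fM tens_lift_g_lin _ _ _.
- move=> r p; apply: (tpos_ext2 (comp_lin tens_lift_g_lin (tl_linr r))
     (comp_lin_mull (f r) tens_lift_g_lin)) p => w.
  by rewrite tlE !tens_lift_gE !big_cons phil mulrA.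
- move=> p r; apply: (tpos_ext2 (comp_lin tens_lift_g_lin (tr_linl r))
     (comp_lin_mulr (f r) tens_lift_g_lin)) p => w.
  have [u [x ->]] := word_last w.
  by rewrite trE wr_mk !tens_lift_gE !wseq_mk !big_cat /= !big_seq1 phir mulrA.
- move=> p q; apply: (tpos_ext2 (comp_lin tens_lift_g_lin (tm_linl q))
     (comp_lin_mulr (g q) tens_lift_g_lin)) p => a /=.
  apply: (tpos_ext2 (comp_lin tens_lift_g_lin (tm_linr (tw a)))
     (comp_lin_mull (g (tw a)) tens_lift_g_lin)) q => b.
  by rewrite tmE !tens_lift_gE wseq_cat big_cat.
Qed.
End TensLift.
End TensorAlgebra.

Record alg_action (K : comNzRingType) (S : algType K) (gT : finGroupType) :=
  AlgAction {
    aact :> gT -> {lrmorphism S -> S};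
    aact1 : forall x, aact 1%g x = x;
    aactM : forall g h x, aact (g * h)%g x = aact g (aact h x) }.

Section SkewAlg.
Variables (K : comNzRingType) (S : algType K) (gT : finGroupType).

(* [a : skew_alg] stands for the sum of the [a g] g, i.e. for an element of
   the tensor product of S and KG. *)
Definition skew_alg (_ : alg_action S gT) := {ffun gT -> S}.

Variable al : alg_action S gT.
HB.instance Definition _ := GRing.Lmodule.on (skew_alg al).

Definition skew_elt (s : S) (g : gT) : skew_alg al :=
  [ffun k => if k == g then s else 0].
Definition skew_one : skew_alg al := skew_elt 1 1%g.
Definition skew_mul (a b : skew_alg al) : skew_alg al :=
  [ffun k => \sum_g a g * al g (b (g^-1 * k)%g)].

Lemma skew_elt_linear g : linear (skew_elt^~ g).
Proof.
move=> c s t; apply/ffunP=> k; rewrite !ffunE.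
by case: ifP => // _; rewrite scaler0 addr0.
Qed.

Lemma skew_algP (a b : skew_alg al) : (forall k, a k = b k) -> a = b.
Proof. by move=> ab; apply/ffunP. Qed.

Lemma skew_sumE (I : Type) (r : seq I) (P : pred I) (F : I -> skew_alg al) k :
  (\sum_(i <- r | P i) F i) k = \sum_(i <- r | P i) F i k.
Proof. by elim/big_rec2: _ => [|i y x _ <-]; rewrite !ffunE. Qed.

Lemma skew_sum (a : skew_alg al) : a = \sum_g skew_elt (a g) g.
Proof.
apply: skew_algP => k; rewrite skew_sumE (bigD1 k) //= ffunE eqxx big1 ?addr0 // => g.
by rewrite ffunE eq_sym => /negPf->.
Qed.

Lemma skew_eltM s g t h :
  skew_mul (skew_elt s g) (skew_elt t h) = skew_elt (s * al g t) (g * h)%g.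
Proof.
apply: skew_algP => k; rewrite !ffunE (bigD1 g) //= !ffunE eqxx big1 ?addr0 => [|g' ne].
  by rewrite (canF_eq (mulKVg g)); case: eqP => // _; rewrite raddf0 mulr0.
by rewrite ffunE (negPf ne) mul0r.
Qed.

Fact skew_mulA : associative skew_mul.
Proof.
move=> a b c; apply: skew_algP => k; rewrite !ffunE.
under eq_bigr => h _.
  rewrite ffunE raddf_sum mulr_sumr (reindex_inj (mulgI h^-1)%g) /=.
  over.
rewrite exchange_big /=; apply: eq_bigr => g _; rewrite ffunE mulr_suml.
apply: eq_bigr => h _; rewrite rmorphM /= mulrA -aactM mulKVg.
by rewrite invMg invgK -!mulgA mulKVg.
Qed.
Fact skew_mul1 : left_id skew_one skew_mul.
Proof.
move=> a; apply: skew_algP => k; rewrite ffunE (bigD1 1%g) //= big1 ?addr0 => [|g ne].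
  by rewrite ffunE eqxx mul1r aact1 invg1 mul1g.
by rewrite ffunE (negPf ne) mul0r.
Qed.
Fact skew_mulr1 : right_id skew_one skew_mul.
Proof.
move=> a; apply: skew_algP => k; rewrite ffunE (bigD1 k) //= big1 ?addr0 => [|g ne].
  by rewrite ffunE mulVg eqxx rmorph1 mulr1.
rewrite ffunE -eq_mulVg1; move/negPf: ne => ->.
by rewrite raddf0 mulr0.
Qed.
Fact skew_mulDl : left_distributive skew_mul +%R.
Proof.
move=> a b c; apply: skew_algP => k; rewrite !ffunE -big_split.
by apply: eq_bigr => g _; rewrite ffunE mulrDl.
Qed.
Fact skew_mulDr : right_distributive skew_mul +%R.
Proof.
move=> a b c; apply: skew_algP => k; rewrite !ffunE -big_split.
by apply: eq_bigr => g _; rewrite ffunE raddfD mulrDr.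
Qed.
Fact skew_one_neq0 : skew_one != 0.
Proof. by apply/eqP=> /ffunP/(_ 1%g)/eqP; rewrite !ffunE eqxx oner_eq0. Qed.
HB.instance Definition _ := GRing.Zmodule_isNzRing.Build (skew_alg al)
  skew_mulA skew_mul1 skew_mulr1 skew_mulDl skew_mulDr skew_one_neq0.
Fact skew_scalerAl (c : K) (a b : skew_alg al) : c *: (a * b) = (c *: a) * b.
Proof.
apply: skew_algP => k; rewrite !ffunE scaler_sumr.
by apply: eq_bigr => g _; rewrite !ffunE scalerAl.
Qed.
HB.instance Definition _ :=
  GRing.Lmodule_isLalgebra.Build K (skew_alg al) skew_scalerAl.
Fact skew_scalerAr (c : K) (a b : skew_alg al) : c *: (a * b) = a * (c *: b).
Proof.
apply: skew_algP => k; rewrite !ffunE scaler_sumr.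
by apply: eq_bigr => g _; rewrite !ffunE linearZ scalerAr.
Qed.
HB.instance Definition _ :=
  GRing.Lalgebra_isAlgebra.Build K (skew_alg al) skew_scalerAr.
End SkewAlg.

Section GroupAlg.
Variables (K : comNzRingType) (gT : finGroupType).

Definition triv_action : alg_action K^o gT :=
  @AlgAction K K^o gT (fun=> idfun) (fun=> erefl) (fun _ _ _ => erefl).
Definition group_alg := skew_alg triv_action.
HB.instance Definition _ := GRing.Algebra.on group_alg.
Definition gelt (g : gT) : group_alg := skew_elt triv_action 1 g.
End GroupAlg.

Record diag_action (K : comNzRingType) (gT : finGroupType) (n : nat) := DiagAction {
  chi :> 'I_n -> gT -> K;
  chi1 : forall i, chi i 1%g = 1;
  chiM : forall i g h, chi i (g * h)%g = chi i g * chi i h }.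

Section DiagAction.
Variables (K : comNzRingType) (gT : finGroupType) (n : nat).
Variable act : diag_action K gT n.
Local Notation V := 'rV[K]_n.

Definition vb (i : 'I_n) : V := delta_mx 0 i.
Definition gact (g : gT) (v : V) : V := \row_i (act i g * v 0 i).

Lemma gact_vb g i : gact g (vb i) = act i g *: vb i.
Proof.
apply/rowP=> j; rewrite !mxE eqxx; case: eqP => [->|] //.
by rewrite !mulr0.
Qed.

Lemma gact_linear g : linear (gact g).
Proof. by move=> c v w; apply/rowP=> i; rewrite !mxE mulrDr mulrCA. Qed.
HB.instance Definition _ g :=
  GRing.isLinear.Build K V V *:%R (gact g) (gact_linear g).

Lemma gact1 v : gact 1 v = v.
Proof. by apply/rowP=> i; rewrite mxE chi1 mul1r. Qed.

Lemma gactM g h v : gact (g * h) v = gact g (gact h v).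
Proof. by apply/rowP=> i; rewrite !mxE chiM mulrA. Qed.

Definition scalar_bimodule : @bimodule K K^o V.
Proof.
refine (@Bimodule K K^o V (fun c v => c *: v) (fun v c => c *: v)
          _ _ _ _ _ _ _ _ _).
- by move=> v c r s; rewrite scalerDl scalerA.
- by move=> r c v w; rewrite scalerDr !scalerA mulrC.
- by move=> r c v w; rewrite scalerDr !scalerA mulrC.
- by move=> v c r s; rewrite scalerDl scalerA.
- exact: scale1r.
- by move=> r s v; rewrite scalerA.
- exact: scale1r.
- by move=> r s v; rewrite scalerA mulrC.
- by move=> r v s; rewrite !scalerA mulrC.
Defined.

Definition TV := tensor_alg scalar_bimodule.
HB.instance Definition _ := GRing.Algebra.on TV.

Definition tv_in (v : V) : TV := tens_in scalar_bimodule v.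

Definition tv_scal (c : K^o) : TV := (c : K) *: (1 : TV).

Definition tv_act (g : gT) : TV -> TV :=
  tens_lift tv_scal (fun v => tv_in (gact g v)).

Fact tv_scal_lin : linear tv_scal.
Proof. by move=> c r s; rewrite /tv_scal scalerDl scalerA. Qed.
Fact tv_scalM : {morph tv_scal : r s / r * s}.
Proof. by move=> r s; rewrite /tv_scal -scalerAl mul1r scalerA. Qed.
Fact tv_in_lin g : linear (fun v => tv_in (gact g v)).
Proof. exact: comp_lin (tens_in_linear _) (gact_linear g). Qed.
Fact tv_in_scall g r x : 
  tv_in (gact g (lact scalar_bimodule r x)) = tv_scal r * tv_in (gact g x).
Proof. rewrite [lact _ _ _]/(r *: x); by rewrite (linZ (tv_in_lin g)) -scalerAl mul1r. Qed.
Fact tv_in_scalr g x r : 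
  tv_in (gact g (ract scalar_bimodule x r)) = tv_in (gact g x) * tv_scal r.
Proof. rewrite [ract _ _ _]/(r *: x); by rewrite (linZ (tv_in_lin g)) -scalerAr mulr1. Qed.

Fact tv_act_linear g : linear (tv_act g).
Proof.
exact: (@tens_lift_linear K _ V scalar_bimodule TV _ _ tv_scal_lin (tv_in_lin g) (tv_in_scall g) (tv_in_scalr g)).
Qed.
Fact tv_act_monoid g : monoid_morphism (tv_act g).
Proof.
split.
  exact: (@tens_lift1 K _ V scalar_bimodule TV _ _ (scale1r _) (tv_in_lin g) (tv_in_scall g) (tv_in_scalr g)).
exact: (@tens_liftM K _ V scalar_bimodule TV _ _ tv_scalM (tv_in_lin g) (tv_in_scall g) (tv_in_scalr g)).
Qed.
HB.instance Definition _ g := GRing.isLinear.Build K TV TV *:%R (tv_act g)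
  (tv_act_linear g).
HB.instance Definition _ g := GRing.isMonoidMorphism.Build TV TV (tv_act g)
  (tv_act_monoid g).

Lemma tv_act_in g v : tv_act g (tv_in v) = tv_in (gact g v).
Proof.
exact: (@tens_lift_in K _ V scalar_bimodule TV _ _ tv_scal_lin (tv_in_lin g) (tv_in_scall g) (tv_in_scalr g) v).
Qed.

Lemma tv_scalE r : tens_scal scalar_bimodule r = tv_scal r.
Proof. by apply: (congr2 pair) => /=; [exact/esym/mulr1 | rewrite scaler0]. Qed.

Lemma tv_ext (f f' : {lrmorphism TV -> TV}) :
  (forall v, f (tv_in v) = f' (tv_in v)) -> f =1 f'.
Proof.
move=> ff'; elim/tens_ind=> [c a b IHa IHb|r|s].
- by rewrite !linearP /= IHa IHb.
- by rewrite tv_scalE /tv_scal !linearZ !rmorph1.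
- by rewrite !rmorph_prod; apply: eq_bigr => x _; apply: ff'.
Qed.

Fact tv_act1 x : tv_act 1%g x = x.
Proof. by apply: (@tv_ext (tv_act 1%g) idfun) x => v; rewrite /= tv_act_in gact1. Qed.
Fact tv_actM g h x : tv_act (g * h)%g x = tv_act g (tv_act h x).
Proof.
apply: (@tv_ext (tv_act (g * h)%g) (tv_act g \o tv_act h)) x => v.
by rewrite /= !tv_act_in gactM.
Qed.

Definition tv_action : alg_action TV gT :=
  @AlgAction K TV gT (fun g => tv_act g) tv_act1 tv_actM.

(* The skew group algebra of T(V) and G *)
Definition TVG := skew_alg tv_action.
HB.instance Definition _ := GRing.Algebra.on TVG.

(* V (x) KG, where [x : VG] stands for the sum of the [x g] (x) g *)
Definition VG := {ffun gT -> V}.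
HB.instance Definition _ := GRing.Lmodule.on VG.

Definition vtens (v : V) (g : gT) : VG := [ffun k => if k == g then v else 0].

Definition VG_in (x : VG) : TVG := [ffun g => tv_in (x g)].

Definition VG_lact (r : group_alg K gT) (x : VG) : VG :=
  [ffun k => \sum_g (r g : K) *: gact g (x (g^-1 * k)%g)].
Definition VG_ract (x : VG) (r : group_alg K gT) : VG :=
  [ffun k => \sum_g (r g : K) *: x (k * g^-1)%g].

Lemma VG_lact_elt g v h : VG_lact (gelt K g) (vtens v h) = vtens (gact g v) (g * h)%g.
Proof.
apply/ffunP=> k; rewrite !ffunE (bigD1 g) //= !ffunE eqxx big1 ?addr0 => [|g' ne].
  rewrite scale1r (canF_eq (mulKVg g)); case: eqP => // _.
  exact: lin0 (gact_linear g).
by rewrite ffunE (negPf ne) scale0r.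
Qed.

Lemma VG_ract_elt v h g : VG_ract (vtens v h) (gelt K g) = vtens v (h * g)%g.
Proof.
apply/ffunP=> k; rewrite !ffunE (bigD1 g) //= !ffunE eqxx big1 ?addr0 => [|g' ne].
  by rewrite scale1r (canF_eq (mulgKV g)).
by rewrite ffunE (negPf ne) scale0r.
Qed.

Local Notation KG := (group_alg K gT).

Fact VG_lact_linl x : linear (VG_lact^~ x).
Proof.
move=> c r s; apply/ffunP=> k; rewrite !ffunE scaler_sumr -big_split.
by apply: eq_bigr => g _; rewrite !ffunE scalerDl scalerA.
Qed.
Fact VG_lact_linr r : linear (VG_lact r).
Proof.
move=> c x y; apply/ffunP=> k; rewrite !ffunE scaler_sumr -big_split.
apply: eq_bigr => g _; rewrite !ffunE linearP /= scalerDr !scalerA.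
by rewrite mulrC.
Qed.
Fact VG_ract_linl r : linear (VG_ract^~ r).
Proof.
move=> c x y; apply/ffunP=> k; rewrite !ffunE scaler_sumr -big_split.
apply: eq_bigr => g _; rewrite !ffunE scalerDr !scalerA.
by rewrite mulrC.
Qed.
Fact VG_ract_linr x : linear (VG_ract x).
Proof.
move=> c r s; apply/ffunP=> k; rewrite !ffunE scaler_sumr -big_split.
by apply: eq_bigr => g _; rewrite !ffunE scalerDl scalerA.
Qed.
Fact VG_lact1 x : VG_lact 1 x = x.
Proof.
apply/ffunP=> k; rewrite ffunE (bigD1 1%g) //= big1 ?addr0 => [|g ne].
  by rewrite ffunE eqxx scale1r gact1 invg1 mul1g.
by rewrite ffunE (negPf ne) scale0r.
Qed.
Fact VG_ract1 x : VG_ract x 1 = x.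
Proof.
apply/ffunP=> k; rewrite ffunE (bigD1 1%g) //= big1 ?addr0 => [|g ne].
  by rewrite ffunE eqxx scale1r invg1 mulg1.
by rewrite ffunE (negPf ne) scale0r.
Qed.
Fact VG_lactM r s x : VG_lact (r * s) x = VG_lact r (VG_lact s x).
Proof.
apply/ffunP=> k; rewrite !ffunE.
under eq_bigr do rewrite ffunE scaler_suml.
rewrite exchange_big /=; apply: eq_bigr => h _; rewrite ffunE.
rewrite linear_sum scaler_sumr (reindex_inj (mulgI h)) /=.
apply: eq_bigr => g _; rewrite linearZ scalerA /= mulKg gactM.
by rewrite invMg mulgA.
Qed.
Fact VG_ractM r s x : VG_ract x (r * s) = VG_ract (VG_ract x r) s.
Proof.
apply/ffunP=> k; rewrite !ffunE.
under eq_bigr do rewrite ffunE scaler_suml.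
under [RHS]eq_bigr do rewrite ffunE scaler_sumr.
rewrite exchange_big [RHS]exchange_big /=; apply: eq_bigr => h _.
rewrite (reindex_inj (mulgI h)) /=; apply: eq_bigr => g _.
by rewrite scalerA mulKg mulrC invMg mulgA.
Qed.
Fact VG_lractA r x s : VG_lact r (VG_ract x s) = VG_ract (VG_lact r x) s.
Proof.
apply/ffunP=> k; rewrite !ffunE.
under eq_bigr do rewrite ffunE linear_sum scaler_sumr.
under [RHS]eq_bigr do rewrite ffunE scaler_sumr.
rewrite exchange_big /=; apply: eq_bigr => h _; apply: eq_bigr => g _.
by rewrite linearZ /= !scalerA mulrC mulgA.
Qed.

Definition VG_bimodule : @bimodule K KG VG := @Bimodule K KG VG
  VG_lact VG_ract VG_lact_linl VG_lact_linr VG_ract_linl VG_ract_linr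
  VG_lact1 VG_lactM VG_ract1 VG_ractM VG_lractA.
End DiagAction.

(* The additive group W written multiplicatively, as [groupType] requires *)
Definition mulgrp (W : zmodType) : Type := W.
HB.instance Definition _ (W : zmodType) := Choice.on (mulgrp W).
HB.instance Definition _ (W : zmodType) := isGroup.Build (mulgrp W)
  (@addrA W) (@add0r W) (@addr0 W) (@addNr W) (@addrN W).

Section Grading.
Variables (A : groupType) (K : fieldType).

Record grading (M : lmodType K) (Mg : A -> M -> Prop) : Prop := Grading {
  grading0 : forall a, Mg a 0;
  gradingP : forall a c x y, Mg a x -> Mg a y -> Mg a (c *: x + y);
  grading_span : forall x, exists (s : seq A) (f : A -> M),
    (forall a, Mg a (f a)) /\ x = \sum_(a <- s) f a;
  grading_direct : forall (s : seq A) (f : A -> M), uniq s ->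
    (forall a, Mg a (f a)) -> \sum_(a <- s) f a = 0 ->
    {in s, forall a, f a = 0} }.

Definition graded_alg (R : algType K) (Rg : A -> R -> Prop) : Prop :=
  grading Rg /\
  forall a b r s, Rg a r -> Rg b s -> Rg (a * b)%g (r * s).

Definition graded_bimodule (R : algType K) (Rg : A -> R -> Prop)
    (L : lmodType K) (B : bimodule R L) (Lg : A -> L -> Prop) : Prop :=
  grading Lg /\
  forall a b c r x s, Rg a r -> Lg b x -> Rg c s ->
    Lg (a * b * c)%g (ract B (lact B r x) s).

(* x is homogeneous and |x| = a, with the convention |0| = 1 *)
Definition hdeg (M : lmodType K) (Mg : A -> M -> Prop) (x : M) (a : A) : Prop :=
  (x = 0 /\ a = 1%g) \/ (x <> 0 /\ Mg a x).

Record antisym_bicharacter (eps : A -> A -> K) : Prop := AntisymBicharacter {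
  bichar_neq0 : forall a b, eps a b != 0;
  bicharMr : forall a b c, eps a (b * c)%g = eps a b * eps a c;
  bicharMl : forall a b c, eps (a * b)%g c = eps a c * eps b c;
  bicharV : forall a b, eps b a = (eps a b)^-1 }.
End Grading.

Section ColorLie.
Variables (A : groupType) (K : fieldType) (eps : A -> A -> K).
Variables (R : algType K) (Rg : A -> R -> Prop).
Variables (L : lmodType K) (B : bimodule R L) (Lg : A -> L -> Prop).
Variable br : L -> L -> L.

Record ungraded_color_lie_ring : Prop := UngradedColorLieRing {
  clr_abelian : forall a b : A, (a * b = b * a)%g;
  clr_bichar : antisym_bicharacter eps;
  clr_gradedR : graded_alg Rg;
  clr_gradedL : graded_bimodule Rg B Lg;
  clr_linl : forall y, linear (br^~ y);
  clr_linr : forall x, linear (br x);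
  clr_bilin : forall r s x y,
    br (lact B r x) (ract B y s) = ract B (lact B r (br x y)) s;
  clr_balanced : forall r x y, br (ract B x r) y = br x (lact B r y);
  clr_antisym : forall x y a b, hdeg Lg x a -> hdeg Lg y b ->
    br x y = - (eps a b *: br y x);
  clr_jacobi : forall x y z a b c,
    hdeg Lg x a -> hdeg Lg y b -> hdeg Lg z c ->
    eps c a *: br x (br y z) + eps a b *: br y (br z x)
      + eps b c *: br z (br x y) = 0 }.

Definition univ_env_rel (t : tensor_alg B) : Prop :=
  exists u v a b, [/\ hdeg Lg u a, hdeg Lg v b &
    t = tens_in B u * tens_in B v - eps a b *: (tens_in B v * tens_in B u)
        - tens_in B (br u v)].

Definition univ_env := quot_alg univ_env_rel.
HB.instance Definition _ := GRing.Lmodule.on univ_env.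
HB.instance Definition _ := GRing.PzRing.on univ_env.
End ColorLie.

Section Quantum.
Variables (K : fieldType) (gT : finGroupType) (n : nat).
Variables (act : diag_action K gT n) (q : 'I_n -> 'I_n -> K).
Variable kappa : {bilinear 'rV[K]_n -> 'rV[K]_n -> VG K gT n}.

Definition quantum_params : Prop :=
  [/\ forall i j, q i j != 0, forall i, q i i = 1
    & forall i j, q j i = (q i j)^-1].

Definition parameter_function : Prop :=
  forall i j, kappa (vb K i) (vb K j) = - (q i j *: kappa (vb K j) (vb K i)).

Definition TVG_in (t : TV K n) : TVG act := skew_elt (tv_action act) t 1%g.

Definition H_rel (x : TVG act) : Prop :=
  exists i j, x =
    TVG_in (tv_in (vb K i) * tv_in (vb K j)
            - q i j *: (tv_in (vb K j) * tv_in (vb K i)))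
    - VG_in act (kappa (vb K i) (vb K j)).

Definition H_alg := quot_alg H_rel.
HB.instance Definition _ := GRing.Lmodule.on H_alg.
HB.instance Definition _ := GRing.PzRing.on H_alg.

(* v_1 ^ m_1 ... v_n ^ m_n g *)
Definition pbw_monomial (mg : {ffun 'I_n -> nat} * gT) : TVG act :=
  skew_elt (tv_action act) (\prod_(i < n) tv_in (vb K i) ^+ mg.1 i) mg.2.

Definition quantum_drinfeld_orbifold_algebra : Prop :=
  is_basis (fun mg => quot_pi H_rel (pbw_monomial mg)).

Definition vanishing_condition : Prop :=
  forall (g : gT) (i j k r : 'I_n), i != j -> i != k -> j != k ->
    kappa (vb K i) (vb K j) g 0 r != 0 ->
    gact act g (vb K k) = (q i k * q j k * q k r) *: vb K k.

Definition ZnG := (mulgrp 'rV[int]_n * gT)%type.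
HB.instance Definition _ := Group.on ZnG.

Definition deg_v (i : 'I_n) : ZnG := (delta_mx 0 i, 1%g).
Definition deg_g (g : gT) : ZnG := (1%g, g).

(* Gradings for which the basis vectors v_i, g, resp. v_i (x) g are homogeneous *)
Definition V_grading (a : ZnG) (v : 'rV[K]_n) : Prop :=
  forall i, v 0 i != 0 -> deg_v i = a.
Definition KG_grading (a : ZnG) (r : group_alg K gT) : Prop :=
  forall g, r g != 0 -> deg_g g = a.
Definition VG_grading (a : ZnG) (x : VG K gT n) : Prop :=
  forall i g, x g 0 i != 0 -> (deg_v i * deg_g g)%g = a.

Definition yetter_drinfeld (A : groupType) (eps : A -> A -> K)
    (Vg : A -> 'rV[K]_n -> Prop) (dG : gT -> A)
    (Rg : A -> group_alg K gT -> Prop) (Lg : A -> VG K gT n -> Prop) : Prop :=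
  [/\ grading Vg,
      forall g, Rg (dG g) (gelt K g),
      forall g a v, Vg a v -> Lg (a * dG g)%g (vtens v g) &
      forall g a v, hdeg Vg v a -> gact act g v = eps (dG g) a *: v].

(* The bilinear extension of [v (x) g, w (x) h] = kappa(v, g w) gh *)
Definition VG_bracket (x y : VG K gT n) : VG K gT n :=
  \sum_g \sum_h VG_ract (kappa (x g) (gact act g (y h))) (gelt K (g * h)%g).

Lemma VG_bracketE v g w h :
  VG_bracket (vtens v g) (vtens w h)
    = VG_ract (kappa v (gact act g w)) (gelt K (g * h)%g).
Proof.
have r0 r : VG_ract (0 : VG K gT n) r = 0 := lin0 (VG_ract_linl r).
rewrite /VG_bracket (bigD1 g) //= [X in _ + X]big1 ?addr0 => [|g' ne]; last first.
  by rewrite big1 // => h' _; rewrite ffunE (negPf ne) linear0l r0.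
rewrite (bigD1 h) //= big1 ?addr0 => [|h' ne].
  by rewrite !ffunE !eqxx.
by rewrite [vtens w h h']ffunE (negPf ne) linear0 linear0r r0.
Qed.

End Quantum.

(* Main.v *)
(** In the quotient H, both the conjugation of a defining relation by g and the
    q-commutator Jacobi identity for v_i, v_j, v_k become relations between
    elements of V (x) KG, which the PBW property makes linearly independent.  The
    first yields the G-equivariance of kappa; for distinct i, j, k the second
    yields the color Jacobi identity, because the vanishing condition is exactly
    what turns each v_i kappa(v_j, v_k) - q_ij q_ik kappa(v_j, v_k) v_i into a
    bracket, and repeated indices are covered by antisymmetry.  Finally T(V) >< G
    and the tensor algebra of L over KG are isomorphic by extending v |-> v (x) 1
    and g |-> g, and this matches the relations of H with those of U(L). *)
Require Import Defs.
From HB Require Import structures.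
From mathcomp Require Import all_boot all_order all_fingroup all_algebra.
From mathcomp Require Import ring.
(* Undoes the shadowing of [gact], [ract], ... by fingroup. *)
Import Defs.

Set Implicit Arguments.
Unset Strict Implicit.
Unset Printing Implicit Defensive.

Import GRing.Theory.
Local Open Scope ring_scope.

(** * Gradings in which every coordinate has a degree *)

Section CoordinateGrading.
Variables (K : fieldType) (A : groupType) (M : lmodType K) (I : finType).
Variables (coord : M -> I -> K) (mk : (I -> K) -> M) (deg : I -> A).
Hypotheses (coord_lin : forall i c x y,
              coord (c *: x + y) i = c * coord x i + coord y i)
           (coordK : forall f i, coord (mk f) i = f i)
           (coord_inj : forall x y, coord x =1 coord y -> x = y).

(** The component of [x] in degree [a] keeps the coordinates of degree [a] and erases the others. In
    a sum of homogeneous elements of distinct degrees, coordinate [i] can only come from the summand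
    of degree [deg i], so no cancellation occurs. *)
Lemma coord_grading :
  grading (fun a x => forall i, coord x i != 0 -> deg i = a).
Proof.
have coord0 i : coord 0 i = 0.
  by have := coord_lin i (-1) 0 0; rewrite scaler0 addr0 mulN1r addNr.
have coord_sum (J : Type) (s : seq J) (f : J -> M) i :
    coord (\sum_(j <- s) f j) i = \sum_(j <- s) coord (f j) i.
  elim: s => [|j s IHs]; first by rewrite !big_nil.
  by rewrite !big_cons -IHs -[f j]scale1r coord_lin mul1r scale1r.
split=> [a i|a c x y xa ya i|x|s f s_uniq f_hom sum0].
- by rewrite coord0 eqxx.
- rewrite coord_lin => nz; case: (eqVneq (coord x i) 0) => [x0|/xa//].
  by apply: ya; rewrite x0 mulr0 add0r in nz.
- exists (undup (map deg (enum I))).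
  exists (fun a => mk (fun i => if deg i == a then coord x i else 0)).
  split=> [a i|].
    by rewrite coordK; case: (eqVneq (deg i) a) => //; rewrite eqxx.
  apply: coord_inj => i; rewrite coord_sum (bigD1_seq (deg i)) ?undup_uniq //=.
    rewrite coordK eqxx big1 ?addr0 // => a; rewrite coordK eq_sym.
    by move=> /negPf->.
  by rewrite mem_undup map_f // mem_enum.
- move=> a sa; apply: coord_inj => i; rewrite coord0.
  apply/eqP; apply/negPn/negP => nz.
  have := coord_sum _ s f i; rewrite sum0 coord0 (bigD1_seq a) //= big1.
    by rewrite addr0 => /esym/eqP; rewrite (negPf nz).
  move=> b ne_ba; apply/eqP; apply/negPn/negP => /f_hom Eb.
  by case/eqP: ne_ba; rewrite -Eb (f_hom a).
Qed.

(** When distinct coordinates have distinct degrees, each homogeneous component is at most a line,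
    spanned by a basis vector. *)
Lemma coord_homP a x : (forall i, coord x i != 0 -> deg i = a) -> injective deg ->
  x <> 0 -> exists2 i, deg i = a & coord x =1 (fun j => if j == i then coord x i else 0).
Proof.
move=> xa deg_inj x_neq0.
have coord0 i : coord 0 i = 0.
  by have := coord_lin i (-1) 0 0; rewrite scaler0 addr0 mulN1r addNr.
case: (pickP (fun i => coord x i != 0)) => [i nzi|z]; last first.
  by case: x_neq0; apply: coord_inj => i; rewrite coord0; apply/eqP/negPn; rewrite z.
exists i => [|j]; first exact: xa.
case: eqP => [->//|ne_ji]; apply/eqP/negPn/negP => /xa Ej.
by apply/ne_ji/deg_inj; rewrite Ej (xa i).
Qed.
End CoordinateGrading.

(** * The gradings of V, KG and V (x) KG by Z^n x G *)

Section ZnGDegrees.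
Variables (K : fieldType) (gT : finGroupType) (n : nat).

Lemma ZnG_mulE (a b : ZnG gT n) : (a * b)%g = ((a.1 : 'rV[int]_n) + b.1, (a.2 * b.2)%g).
Proof. by []. Qed.

Lemma deg_vgE i (g : gT) :
  (deg_v gT i * deg_g n g)%g = (delta_mx 0 i : mulgrp 'rV[int]_n, g).
Proof. by rewrite ZnG_mulE /= addr0 mul1g. Qed.

Lemma delta_mx0_inj : injective (fun i : 'I_n => delta_mx 0 i : 'rV[int]_n).
Proof.
move=> i j /rowP/(_ i); rewrite !mxE !eqxx; by case: eqP.
Qed.

Lemma deg_v_inj : injective (@deg_v gT n).
Proof. by move=> i j [/delta_mx0_inj]. Qed.

Lemma deg_vg_inj : injective (fun p : 'I_n * gT => (deg_v gT p.1 * deg_g n p.2)%g).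
Proof. by move=> [i g] [j h]; rewrite /= !deg_vgE => -[/delta_mx0_inj-> ->]. Qed.

Lemma V_grading_grading : grading (@V_grading K gT n).
Proof.
apply: (@coord_grading K _ 'rV[K]_n _ (fun v i => v 0 i)
  (fun f => \row_i f i) (@deg_v gT n)) => [i c x y|f i|x y xy].
- by rewrite !mxE.
- by rewrite mxE.
- exact/rowP.
Qed.

Lemma KG_grading_grading : grading (@KG_grading K gT n).
Proof.
apply: (@coord_grading K _ (group_alg K gT) _ (fun r g => r g)
  (fun f => [ffun g => f g]) (@deg_g gT n)) => [g c x y|f g|x y xy].
- by rewrite !ffunE.
- by rewrite ffunE.
- exact/ffunP.
Qed.

Lemma VG_grading_grading : grading (@VG_grading K gT n).
Proof.
have [] := @coord_grading K _ (VG K gT n) _ (fun x p => x p.2 0 p.1)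
  (fun f => [ffun g => \row_i f (i, g)])
  (fun p : 'I_n * gT => (deg_v gT p.1 * deg_g n p.2)%g).
- by move=> p c x y; rewrite !ffunE !mxE.
- by move=> f [i g]; rewrite ffunE mxE.
- by move=> x y xy; apply/ffunP=> g; apply/rowP=> i; apply: (xy (i, g)).
have E a (x : VG K gT n) :
  (forall p : 'I_n * gT, x p.2 0 p.1 != 0 -> (deg_v gT p.1 * deg_g n p.2)%g = a)
    <-> VG_grading a x.
  by split=> [h i g|h [i g]]; [apply: (h (i, g)) | apply: h].
move=> g0 gP gs gd; split.
- by move=> a; apply: (proj1 (E _ _)) (g0 a).
- move=> a c x y /(proj2 (E _ _)) xa /(proj2 (E _ _)) ya.
  exact: (proj1 (E _ _)) (gP _ _ _ _ xa ya).
- move=> x; have [s [f [fh fx]]] := gs x; exists s, f; split=> // a.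
  exact: (proj1 (E _ _)) (fh a).
- by move=> s f us fh; apply: gd => // a; apply: (proj2 (E _ _)) (fh a).
Qed.

Lemma hdeg_VP a (v : 'rV[K]_n) : hdeg (@V_grading K gT n) v a -> v <> 0 ->
  exists c i, a = deg_v gT i /\ v = c *: vb K i.
Proof.
case=> [[->]//|[_ va] v_neq0].
have [||i <- vE] := @coord_homP K _ 'rV[K]_n _ (fun v i => v 0 i) (@deg_v gT n) _ _
  a v va deg_v_inj v_neq0.
- by move=> i c x y; rewrite !mxE.
- by move=> x y xy; apply/rowP.
exists (v 0 i), i; split=> //; apply/rowP=> j; rewrite vE !mxE eqxx /=.
by case: eqP => _; rewrite ?mulr1 ?mulr0.
Qed.

(** Distinct elements v_i (x) g have distinct degrees. Antisymmetry, the Jacobi identity and the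
    relations of U(L), all stated for homogeneous elements, thereby reduce to these basis
    elements. *)
Lemma hdeg_VGP a (x : VG K gT n) : hdeg (@VG_grading K gT n) x a -> x <> 0 ->
  exists c i g, a = (deg_v gT i * deg_g n g)%g /\ x = c *: vtens (vb K i) g.
Proof.
case=> [[->]//|[_ xa] x_neq0].
have [|||[i g] /= <- xE] := @coord_homP K _ (VG K gT n) _ (fun x p => x p.2 0 p.1)
  (fun p : 'I_n * gT => (deg_v gT p.1 * deg_g n p.2)%g) _ _ a x _ deg_vg_inj x_neq0.
- by move=> p c y z; rewrite !ffunE !mxE.
- by move=> y z yz; apply/ffunP=> g; apply/rowP=> i; apply: (yz (i, g)).
- by case=> i g; apply: xa.
exists (x g 0 i), i, g; split=> //; apply/ffunP=> h; apply/rowP=> j.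
have /= -> := xE (j, h); rewrite !ffunE /= !mxE xpair_eqE.
case: (h == g); rewrite ?mxE ?andbF ?mulr0 // andbT eqxx /=.
by case: eqP; rewrite ?mulr1 ?mulr0.
Qed.

Lemma vb_neq0 i : vb K i <> 0 :> 'rV[K]_n.
Proof. by move=> /rowP/(_ i)/eqP; rewrite !mxE !eqxx oner_eq0. Qed.

Lemma hdeg_vtens i g :
  hdeg (@VG_grading K gT n) (vtens (vb K i) g) (deg_v gT i * deg_g n g)%g.
Proof.
right; split=> [/ffunP/(_ g)|j h].
  by rewrite !ffunE eqxx => /vb_neq0.
rewrite ffunE; case: (h =P g) => [->|_]; last by rewrite mxE eqxx.
by rewrite !mxE eqxx /=; case: (eqVneq j i) => [->//|_]; rewrite eqxx.
Qed.

Lemma KG_graded_alg : graded_alg (@KG_grading K gT n).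
Proof.
split=> [|a b r s ra sb g]; first exact: KG_grading_grading.
rewrite ffunE => nz.
(* A nonzero coefficient of a convolution product has at least one nonzero term; its two factors
   determine [a] and [b]. *)
have [h /andP[rh sh]] : exists h, (r h != 0) && (s (h^-1 * g)%g != 0).
  apply/existsP; apply: contraNT nz => /existsPn z.
  rewrite big1 // => h _; apply/eqP; have := z h; rewrite negb_and !negbK.
  by case/orP=> /eqP /= ->; rewrite ?mul0r ?mulr0.
by rewrite -(ra _ rh) -(sb _ sh) ZnG_mulE /= addr0 mulKVg.
Qed.

Lemma VG_graded_bimodule (act : diag_action K gT n) :
  graded_bimodule (@KG_grading K gT n) (VG_bimodule act) (@VG_grading K gT n).
Proof.
split=> [|a b c r x s ra xb sc i g]; first exact: VG_grading_grading.
rewrite ffunE summxE => nz.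
have [h /andP[sh]] : exists h, (s h != 0) &&
    (VG_lact act r x (g * h^-1)%g 0 i != 0).
  apply/existsP; apply: contraNT nz => /existsPn z.
  rewrite big1 // => h _; apply/eqP; have := z h; rewrite negb_and !negbK.
  by rewrite mxE; case/orP=> /eqP /= ->; rewrite ?mul0r ?mulr0.
rewrite ffunE summxE => nz'.
have [k /andP[rk xk]] : exists k, (r k != 0) &&
    (x (k^-1 * (g * h^-1))%g 0 i != 0).
  apply/existsP; apply: contraNT nz' => /existsPn z.
  rewrite big1 // => k _; apply/eqP; have := z k; rewrite negb_and !negbK.
  by rewrite !mxE; case/orP=> /eqP /= ->; rewrite ?mul0r ?mulr0.
rewrite -(ra _ rk) -(sc _ sh) -(xb _ _ xk) !ZnG_mulE /= !addr0 add0r !mul1g.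
by rewrite mulKVg mulgKV.
Qed.
End ZnGDegrees.

(** * The antisymmetric bicharacter of (a) *)

Section Bicharacter.
Variables (K : fieldType) (gT : finGroupType) (n : nat).
Variables (act : diag_action K gT n) (q : 'I_n -> 'I_n -> K).
Hypothesis q_quantum : quantum_params q.

Local Notation vec a := (a.1 : 'rV[int]_n).

(** Part (a) prescribes values on pairs of degrees (a_i, g), (a_j, h). This is the extension
    multiplicative in each argument that is trivial on pairs of elements of G. *)
Definition color_bichar (a b : ZnG gT n) : K :=
  (\prod_i \prod_j q i j ^ (vec a 0 i * vec b 0 j))
  * (\prod_i act i b.2 ^ (- vec a 0 i)) * \prod_j act j a.2 ^ vec b 0 j.

Lemma chi_neq0 i g : act i g != 0.
Proof.
apply/eqP => z; have := chi1 act i; rewrite -(mulgV g) chiM z mul0r.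
by move/esym/eqP; rewrite oner_eq0.
Qed.

Lemma prodrD2 (I : finType) (f : I -> K) (u v : I -> int) : (forall i, f i != 0) ->
  \prod_i f i ^ (u i + v i) = (\prod_i f i ^ u i) * \prod_i f i ^ v i.
Proof. by move=> f0; rewrite -big_split; apply: eq_bigr => i _; rewrite expfzDr. Qed.

(** Exchanging the arguments inverts the q-factor because q_ji = q_ij^-1, and swaps the two
    character factors, whose exponents have opposite signs. Multiplicativity on the left then
    follows from multiplicativity on the right. *)
Lemma color_bichar_antisym : antisym_bicharacter color_bichar.
Proof.
have [q0 _ qV] := q_quantum.
have MrE a b c : color_bichar a (b * c)%g = color_bichar a b * color_bichar a c.
  rewrite /color_bichar /= [RHS]mulrACA; congr (_ * _).
    rewrite [RHS]mulrACA; congr (_ * _).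
      rewrite -big_split; apply: eq_bigr => i _; rewrite /= -prodrD2 //.
      by apply: eq_bigr => j _; rewrite mxE mulrDr.
    by rewrite -big_split; apply: eq_bigr => i _; rewrite chiM expfzMl.
  by rewrite -prodrD2 => [|i]; [apply: eq_bigr => j _; rewrite mxE | apply: chi_neq0].
have VE a b : color_bichar b a = (color_bichar a b)^-1.
  rewrite /color_bichar !invfM -!mulrA; congr (_ * _).
    rewrite exchange_big -prodfV; apply: eq_bigr => i _.
    rewrite -prodfV; apply: eq_bigr => j _.
    by rewrite qV exprz_inv invr_expz mulrC.
  rewrite [RHS]mulrC -!prodfV; congr (_ * _); apply: eq_bigr => i _.
    by rewrite invr_expz.
  by rewrite invr_expz opprK.
have neq0 a b : color_bichar a b != 0.
  rewrite /color_bichar !mulf_neq0 //; apply/prodf_neq0 => i _; rewrite ?expfz_neq0 ?chi_neq0 //.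
  by apply/prodf_neq0 => j _; rewrite expfz_neq0.
split=> // a b c.
by rewrite VE MrE invfM -!VE.
Qed.

Lemma color_bicharE g h i j :
  color_bichar (deg_v gT i * deg_g n g)%g (deg_v gT j * deg_g n h)%g
    = q i j * (act i h)^-1 * act j g.
Proof.
rewrite !deg_vgE /color_bichar /=; congr (_ * _ * _).
- rewrite (bigD1 i) //= (bigD1 j) //= !mxE !eqxx expr1z !big1 ?mulr1 // => k ne.
    by rewrite big1 // => l _; rewrite !mxE (negPf ne) andbF mul0r expr0z.
  by rewrite !mxE (negPf ne) andbF mulr0 expr0z.
- rewrite (bigD1 i) //= mxE !eqxx big1 ?mulr1 => [|k ne]; first by rewrite -invr_expz expr1z.
  by rewrite !mxE (negPf ne) andbF expr0z.
- rewrite (bigD1 j) //= mxE !eqxx big1 ?mulr1 => [|k ne]; first by rewrite expr1z.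
  by rewrite !mxE (negPf ne) andbF expr0z.
Qed.

(** The Z^n-part of |g| is 0, so the last factor alone survives. This is the Yetter-Drinfeld
    condition on basis vectors. *)
Lemma color_bichar_gv g i : color_bichar (deg_g n g) (deg_v gT i) = act i g.
Proof.
rewrite /color_bichar /= [X in X * _ * _]big1 => [|k _]; last first.
  by rewrite big1 // => j _; rewrite mxE mul0r expr0z.
rewrite [X in _ * X * _]big1 => [|k _]; last by rewrite mxE oppr0 expr0z.
rewrite !mul1r (bigD1 i) //= mxE !eqxx big1 ?mulr1 => [|k ne]; first by rewrite expr1z.
by rewrite !mxE (negPf ne) andbF expr0z.
Qed.
End Bicharacter.

(** * Linear maps compared on basis elements *)

Section LinearExtension.
Variable K : fieldType.

Lemma lin_sum (N N' : lmodType K) (f : N -> N') (I : Type) (s : seq I) (F : I -> N) :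
  linear f -> f (\sum_(i <- s) F i) = \sum_(i <- s) f (F i).
Proof.
move=> fl; elim: s => [|i s IHs]; first by rewrite !big_nil lin0.
by rewrite !big_cons linD // IHs.
Qed.

Lemma linB (N N' : lmodType K) (f : N -> N') : linear f -> {morph f : x y / x - y}.
Proof. by move=> fl x y; rewrite -scaleN1r addrC fl addrC scaleN1r. Qed.

Lemma VG_decomp (gT : finGroupType) n (x : VG K gT n) :
  x = \sum_g \sum_i x g 0 i *: vtens (vb K i) g.
Proof.
apply/ffunP=> h; rewrite sum_ffunE (bigD1 h) //= [X in _ + X]big1 ?addr0 => [|g ne].
  rewrite sum_ffunE [LHS]row_sum_delta; apply: eq_bigr => i _.
  by rewrite !ffunE eqxx.
by rewrite sum_ffunE big1 // => i _; rewrite !ffunE eq_sym (negPf ne) scaler0.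
Qed.

(** The comparison is restricted to the basis elements that occur in [x], because the vanishing
    condition and [kappa_chi] give information only about the nonzero coefficients of kappa(v_i,
    v_j). *)
Lemma VG_eq_at (gT : finGroupType) n (N : lmodType K) (f f' : VG K gT n -> N)
    (x : VG K gT n) : linear f -> linear f' ->
  (forall i g, x g 0 i != 0 -> f (vtens (vb K i) g) = f' (vtens (vb K i) g)) ->
  f x = f' x.
Proof.
move=> fl fl' ff'; rewrite [x]VG_decomp !lin_sum //; apply: eq_bigr => g _.
rewrite !lin_sum //; apply: eq_bigr => i _; rewrite !linZ //.
by case: (eqVneq (x g 0 i) 0) => [->|/ff'->//]; rewrite !scale0r.
Qed.
End LinearExtension.

(** * KG and V (x) KG inside the skew group algebra of an algebra [S], later T(V) *)

Section SkewEmbedding.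
Variables (K : fieldType) (gT : finGroupType) (S : algType K) (al : alg_action S gT).

Definition KG_in (r : group_alg K gT) : skew_alg al := [ffun g => (r g : K) *: (1 : S)].
Local Notation elt := (skew_elt al).

Lemma KG_in_linear : linear KG_in.
Proof. by move=> c r s; apply/ffunP=> g; rewrite !ffunE scalerDl scalerA. Qed.

Lemma KG_in1 : KG_in 1 = 1.
Proof. by apply/ffunP=> g; rewrite !ffunE; case: eqP => _; rewrite ?scale1r ?scale0r. Qed.

Lemma KG_inM : {morph KG_in : r s / r * s}.
Proof.
move=> r s; apply/ffunP=> k; rewrite !ffunE scaler_suml; apply: eq_bigr => g _.
by rewrite !ffunE linearZ /= rmorph1 -scalerAl mul1r scalerA.
Qed.

Lemma KG_in_gelt g : KG_in (gelt K g) = elt 1 g.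
Proof. by apply/ffunP=> h; rewrite !ffunE; case: eqP => _; rewrite ?scale1r ?scale0r. Qed.

Lemma skew_eltME s g t h : elt s g * elt t h = elt (s * al g t) (g * h)%g.
Proof. exact: skew_eltM. Qed.

Lemma skew_elt_in s g : elt s g = elt s 1%g * KG_in (gelt K g).
Proof. by rewrite KG_in_gelt skew_eltME rmorph1 mulr1 mul1g. Qed.

Lemma skew_elt1M : {morph elt^~ 1%g : s t / s * t}.
Proof. by move=> s t; rewrite skew_eltME aact1 mulg1. Qed.

Lemma skew_eltBZ s t c g : elt (s - c *: t) g = elt s g - c *: elt t g.
Proof. by rewrite addrC -scaleNr (skew_elt_linear al g) scaleNr addrC. Qed.

Lemma KG_in_commute g s : KG_in (gelt K g) * elt s 1%g = elt (al g s) 1%g * KG_in (gelt K g).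
Proof. by rewrite !KG_in_gelt !skew_eltME !mul1r rmorph1 mulr1 mulg1 mul1g. Qed.

(* [iota : V -> S] stands for the inclusion of V in S = T(V). *)
Variables (n : nat) (act : diag_action K gT n) (iota : {linear 'rV[K]_n -> S}).
Hypothesis al_iota : forall g v, al g (iota v) = iota (gact act g v).

Definition skew_in (x : VG K gT n) : skew_alg al := [ffun g => iota (x g)].

Lemma skew_in_linear : linear skew_in.
Proof. by move=> c x y; apply/ffunP=> g; rewrite !ffunE linearP. Qed.

Lemma skew_in_lact r x : skew_in (VG_lact act r x) = KG_in r * skew_in x.
Proof.
apply/ffunP=> k; rewrite !ffunE linear_sum; apply: eq_bigr => g _.
by rewrite !ffunE linearZ /= al_iota -scalerAl mul1r.
Qed.

Lemma skew_in_ract x r : skew_in (VG_ract x r) = skew_in x * KG_in r.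
Proof.
apply/ffunP=> k; rewrite !ffunE linear_sum.
(* The product sums over the group element of the left factor, the right action over that of [r];
   the substitution of k g^-1 for g passes between them. *)
rewrite [RHS](reindex_inj (inj_comp (mulgI k) invg_inj)) /=.
apply: eq_bigr => g _; rewrite !ffunE !linearZ /= rmorph1 -scalerAr mulr1.
by rewrite invMg invgK mulgKV.
Qed.

Lemma skew_in_vtens v g : skew_in (vtens v g) = elt (iota v) g.
Proof. by apply/ffunP=> h; rewrite !ffunE; case: eqP => // _; rewrite linear0. Qed.
End SkewEmbedding.

(** * The Jacobi identity for q-commutators *)

Section QuantumJacobi.
Variables (K : fieldType) (B : algType K).

(** Here a, b, c stand for q_ij, q_jk, q_ki, so that a c^-1 = q_ij q_ik is the scalar for moving v_i
    past v_j v_k. After expansion each of the six words in x, y, z appears twice, with opposite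
    coefficients. *)
Lemma q_jacobi (x y z : B) (a b c : K) : a != 0 -> b != 0 -> c != 0 ->
  c *: (x * (y * z - b *: (z * y)) - (a * c^-1) *: ((y * z - b *: (z * y)) * x))
  + a *: (y * (z * x - c *: (x * z)) - (b * a^-1) *: ((z * x - c *: (x * z)) * y))
  + b *: (z * (x * y - a *: (y * x)) - (c * b^-1) *: ((x * y - a *: (y * x)) * z))
  = 0.
Proof.
have E u v w k l m : m != 0 ->
    m *: (u * (v * w - l *: (w * v)) - (k * m^-1) *: ((v * w - l *: (w * v)) * u))
    = m *: (u * v * w) - (m * l) *: (u * w * v) - k *: (v * w * u)
      + (k * l) *: (w * v * u) :> B.
  move=> m0; rewrite scalerBr scalerA mulrCA divff // mulr1.
  by rewrite mulrBr mulrBl -scalerAr -scalerAl !scalerBr !scalerA !mulrA opprB addrA addrAC.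
move=> a0 b0 c0; rewrite !E // [b * c]mulrC [b * a]mulrC [c * a]mulrC.
rewrite [LHS](@GRing.add B).[AC (4*4*4) ((1*11)*(8*2)*(5*3)*(4*10)*(12*6)*(9*7))].
by rewrite !subrr !addr0.
Qed.
End QuantumJacobi.

(** * Bilinearity of the bracket, and the actions of single group elements *)

Section BracketLinear.
Variables (K : fieldType) (gT : finGroupType) (n : nat) (act : diag_action K gT n).
Variable kappa : {bilinear 'rV[K]_n -> 'rV[K]_n -> VG K gT n}.
Local Notation br := (VG_bracket act kappa).

Lemma VG_bracket_linl y : linear (br^~ y).
Proof.
move=> c x x'; rewrite /VG_bracket scaler_sumr -big_split; apply: eq_bigr => g _ /=.
rewrite scaler_sumr -big_split; apply: eq_bigr => h _ /=.
by rewrite !ffunE linearPl VG_ract_linl.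
Qed.

Lemma VG_bracket_linr x : linear (br x).
Proof.
move=> c y y'; rewrite /VG_bracket scaler_sumr -big_split; apply: eq_bigr => g _ /=.
rewrite scaler_sumr -big_split; apply: eq_bigr => h _ /=.
by rewrite !ffunE linearP linearPr VG_ract_linl.
Qed.

Lemma VG_lact_gelt g (x : VG K gT n) k :
  VG_lact act (gelt K g) x k = gact act g (x (g^-1 * k)%g).
Proof.
rewrite ffunE (bigD1 g) //= ffunE eqxx scale1r big1 ?addr0 // => h ne.
by rewrite ffunE (negPf ne) scale0r.
Qed.

Lemma VG_ract_gelt g (x : VG K gT n) k : VG_ract x (gelt K g) k = x (k * g^-1)%g.
Proof.
rewrite ffunE (bigD1 g) //= ffunE eqxx scale1r big1 ?addr0 // => h ne.
by rewrite ffunE (negPf ne) scale0r.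
Qed.
End BracketLinear.

(** * Equivariance of kappa and the color Jacobi identity, read off in the quotient *)

Section QuotientRelations.
Variables (K : fieldType) (gT : finGroupType) (n : nat) (act : diag_action K gT n).
Variables (q : 'I_n -> 'I_n -> K).
Variable kappa : {bilinear 'rV[K]_n -> 'rV[K]_n -> VG K gT n}.
Variables (S : algType K) (al : alg_action S gT) (iota : {linear 'rV[K]_n -> S}).
Hypothesis al_iota : forall g v, al g (iota v) = iota (gact act g v).
Local Notation elt := (skew_elt al).
Local Notation vi i := (iota (vb K i)).
Local Notation kap i j := (kappa (vb K i) (vb K j)).
Local Notation br := (VG_bracket act kappa).
Local Notation inV := (skew_in al iota).
Local Notation Gam g := (KG_in al (gelt K g)).

Definition skew_rel (x : skew_alg al) : Prop :=
  exists i j, x = elt (vi i * vi j - q i j *: (vi j * vi i)) 1%g - inV (kap i j).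
Local Notation pi := (quot_pi skew_rel).

Lemma skew_relE i j :
  pi (elt (vi i * vi j - q i j *: (vi j * vi i)) 1%g) = pi (inV (kap i j)).
Proof.
apply/eqP; rewrite -subr_eq0 -raddfB; apply/eqP; apply: qpi_gen.
by exists 1, (elt (vi i * vi j - q i j *: (vi j * vi i)) 1%g - inV (kap i j)), 1;
  split; [exists i, j | rewrite mul1r mulr1].
Qed.

Hypothesis inV_inj : forall x, pi (inV x) = 0 -> x = 0.

(** Moving g past v_i v_j - q_ij v_j v_i multiplies it by chi_i(g) chi_j(g). In the quotient this
    element equals kappa(v_i, v_j), and [inV_inj] lifts the resulting identity back to V (x) KG. *)
Lemma kappa_invariant g i j :
  VG_lact act (gelt K g) (kap i j)
    = (act i g * act j g) *: VG_ract (kap i j) (gelt K g).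
Proof.
apply/eqP; rewrite -subr_eq0; apply/eqP/inV_inj.
have inV_lin := skew_in_linear al iota.
rewrite -scaleN1r addrC inV_lin (linZ inV_lin) skew_in_lact // skew_in_ract //.
rewrite linearD !linearZ /= !quot_piM -!skew_relE -!quot_piM.
rewrite -!(linZ (quot_pi_linear skew_rel)) -(linD (quot_pi_linear skew_rel)).
rewrite -[RHS](linear0 pi); congr (pi _).
rewrite scaleN1r addrC; apply/eqP; rewrite subr_eq0; apply/eqP.
set e := elt (_ - _) _; rewrite KG_in_commute.
have -> : elt (al g (vi i * vi j - q i j *: (vi j * vi i))) 1%g = (act i g * act j g) *: e.
  rewrite /e -(linZ (skew_elt_linear al 1%g)); congr (elt _ _).
  rewrite rmorphB /= linearZ /= !rmorphM /= !al_iota !gact_vb !linearZ /=.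
  rewrite -!scalerAl -!scalerAr !scalerN !scalerA scalerBr scalerA.
  by congr (_ - _ *: _); rewrite -mulrA mulrC [act j g * _]mulrC.
by rewrite scalerAl.
Qed.

Lemma kappa_chi (abG : abelian [set: gT]) i j h r g :
  kap i j h 0 r != 0 -> act r g = act i g * act j g.
Proof.
(* At the group element gh the left action reads the coefficient at h and the right action the one
   at g h g^-1, which is the same since G is abelian. *)
move=> nz; have := kappa_invariant g i j => /ffunP/(_ (g * h)%g)/rowP/(_ r).
rewrite VG_lact_gelt ffunE VG_ract_gelt !mxE mulKg.
have -> : (g * h * g^-1 = h)%g.
  by rewrite (centsP abG g _ h) ?inE // mulgK.
by move/(mulIf nz).
Qed.

(** For a basis element v_r (x) h of [x], moving v_i to the left of h turns (v_r h) v_i into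
    chi_i(h) v_r v_i h. The hypothesis makes its total coefficient q_ir, so a defining relation
    times h appears, and its value kappa(v_i, v_r) h is the bracket. *)
Lemma overlap i c (x : VG K gT n) :
  (forall r h, x h 0 r != 0 -> c * act i h = q i r) ->
  pi (elt (vi i) 1%g * inV x - c *: (inV x * elt (vi i) 1%g))
    = pi (inV (br (vtens (vb K i) 1%g) x)).
Proof.
move=> xP.
have inV_lin := skew_in_linear al iota.
have br_lin := VG_bracket_linr act kappa (vtens (vb K i) 1%g).
apply: (VG_eq_at (f := fun x => pi (elt (vi i) 1%g * inV x - c *: (inV x * elt (vi i) 1%g)))
  (f' := fun x => pi (inV (br (vtens (vb K i) 1%g) x)))).
- move=> d y y'; rewrite -linearP /=; congr (pi _).
  rewrite inV_lin mulrDr mulrDl !scalerDr -scalerAr -scalerAl scalerN opprD.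
  by rewrite addrACA !scalerA [c * d]mulrC.
- by move=> d y y'; rewrite -linearP /= -inV_lin -br_lin.
move=> r h /xP E; rewrite VG_bracketE gact1 mul1g skew_in_ract // quot_piM -skew_relE.
rewrite -quot_piM; congr (pi _).
rewrite skew_in_vtens (skew_elt_in al _ h) mulrA -skew_elt1M.
rewrite -[_ * _ * elt _ _]mulrA KG_in_commute al_iota gact_vb.
rewrite [iota (_ *: _)]linearZ /= (linZ (skew_elt_linear al 1%g)).
rewrite -scalerAl -scalerAr scalerA E mulrA -skew_elt1M.
by rewrite skew_eltBZ mulrBl -scalerAl.
Qed.

Hypotheses (q_quantum : quantum_params q) (vanish : vanishing_condition act q kappa).

(** By [overlap] each bracket is the image of a q-commutator of v_i with v_j v_k - q_jk v_k v_j, up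
    to cyclic rotation. The weighted sum of these vanishes by [q_jacobi] even before passing to the
    quotient, and [inV_inj] concludes. *)
Lemma bracket_jacobi_distinct i j k : i != j -> i != k -> j != k ->
  q k i *: br (vtens (vb K i) 1%g) (kap j k) + q i j *: br (vtens (vb K j) 1%g) (kap k i)
   + q j k *: br (vtens (vb K k) 1%g) (kap i j) = 0.
Proof.
have [q0 _ qV] := q_quantum.
have inV_lin := skew_in_linear al iota.
have ov i' j' k' : i' != j' -> i' != k' -> j' != k' ->
    let e := elt (vi j' * vi k' - q j' k' *: (vi k' * vi j')) 1%g in
    pi (elt (vi i') 1%g * e - (q i' j' * (q k' i')^-1) *: (e * elt (vi i') 1%g))
      = pi (inV (br (vtens (vb K i') 1%g) (kap j' k'))).
  (* The vanishing condition for a term v_r (x) h of kappa(v_j, v_k) reads chi_i(h) = q_ji q_ki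
     q_ir. Multiplied by q_ij q_ki^-1 it leaves q_ir, as [overlap] requires. *)
  move=> ij ik jk e; rewrite -(@overlap i' (q i' j' * (q k' i')^-1)); last first.
    move=> r h /(vanish); rewrite eq_sym in ij; rewrite eq_sym in ik.
    move=> /(_ i' jk ij ik) /rowP/(_ i'); rewrite gact_vb !mxE !eqxx !mulr1 => ->.
    by rewrite (qV j' i') -invfM mulKf ?mulf_neq0.
  have eE : pi e = pi (inV (kap j' k')) := skew_relE j' k'.
  by rewrite !linearB !linearZ /= !quot_piM eE.
move=> ij ik jk; apply: inV_inj.
rewrite !(linD inV_lin) !(linZ inV_lin) !linearD !linearZ /= -!ov // 1?eq_sym //.
rewrite -!(linZ (quot_pi_linear skew_rel)) -!(linD (quot_pi_linear skew_rel)).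
rewrite -[RHS](linear0 pi); congr (pi _).
by rewrite !skew_eltBZ !skew_elt1M q_jacobi.
Qed.
End QuotientRelations.

(** * The axioms of a color Lie ring for the bracket *)

Section ColorLieRing.
Variables (K : fieldType) (gT : finGroupType) (n : nat) (act : diag_action K gT n).
Variables (q : 'I_n -> 'I_n -> K).
Variable kappa : {bilinear 'rV[K]_n -> 'rV[K]_n -> VG K gT n}.
Local Notation kap i j := (kappa (vb K i) (vb K j)).
Local Notation br := (VG_bracket act kappa).
Local Notation ve i g := (vtens (vb K i) g).
Local Notation KG := (group_alg K gT).
Local Notation bim := (VG_bimodule act).

Lemma KG_eq (N : lmodType K) (f f' : KG -> N) : linear f -> linear f' ->
  (forall g, f (gelt K g) = f' (gelt K g)) -> f =1 f'.
Proof.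
move=> fl fl' ff' r.
have -> : r = \sum_g (r g : K) *: gelt K g.
  apply/ffunP=> h; rewrite skew_sumE (bigD1 h) //= !ffunE eqxx big1 => [|g ne].
    by rewrite addr0 [_ *: _]mulr1.
  by rewrite !ffunE eq_sym (negPf ne) scaler0.
by rewrite !lin_sum //; apply: eq_bigr => g _; rewrite !linZ // ff'.
Qed.

Lemma geltM g h : gelt K g * gelt K h = gelt K (g * h)%g :> KG.
Proof. by rewrite /gelt skew_eltME /= mulr1. Qed.

Lemma VG_ract_gelt2 (x : VG K gT n) g h :
  VG_ract (VG_ract x (gelt K g)) (gelt K h) = VG_ract x (gelt K (g * h)%g).
Proof. by rewrite -VG_ractM geltM. Qed.

Lemma bracket_ve i g j h :
  br (ve i g) (ve j h) = act j g *: VG_ract (kap i j) (gelt K (g * h)%g).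
Proof. by rewrite VG_bracketE gact_vb linearZr /= (linZ (VG_ract_linl _)). Qed.

Hypothesis kappa_inv : forall g i j, VG_lact act (gelt K g) (kap i j)
  = (act i g * act j g) *: VG_ract (kap i j) (gelt K g).

(** Linearity in all four arguments reduces to basis elements. There [kappa_inv] carries g from the
    left of kappa(v_i, v_j) to its right, which produces the scalar chi_i(g) chi_j(g) of the other
    side. *)
Lemma bracket_bilin r s x y :
  br (lact bim r x) (ract bim y s) = ract bim (lact bim r (br x y)) s.
Proof.
have bl := VG_bracket_linl act kappa; have br_ := VG_bracket_linr act kappa.
apply: (VG_eq_at (f := fun x => br (lact bim r x) (ract bim y s))
  (f' := fun x => ract bim (lact bim r (br x y)) s)) => [||i h _].
- exact: comp_lin (bl _) (lact_linr bim r).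
- exact: comp_lin (ract_linl bim s) (comp_lin (lact_linr bim r) (bl _)).
apply: (VG_eq_at (f := fun y => br (lact bim r (ve i h)) (ract bim y s))
  (f' := fun y => ract bim (lact bim r (br (ve i h) y)) s)) => [||j k _].
- exact: comp_lin (br_ _) (ract_linl bim s).
- exact: comp_lin (ract_linl bim s) (comp_lin (lact_linr bim r) (br_ _)).
apply: (KG_eq (f := fun s => br (lact bim r (ve i h)) (ract bim (ve j k) s))
  (f' := fun s => ract bim (lact bim r (br (ve i h) (ve j k))) s)) => [||l] /=.
- exact: comp_lin (br_ _) (ract_linr bim _).
- exact: ract_linr bim _.
apply: (KG_eq (f := fun r => br (lact bim r (ve i h)) (ract bim (ve j k) (gelt K l)))
  (f' := fun r => ract bim (lact bim r (br (ve i h) (ve j k))) (gelt K l))) => [||g] /=.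
- exact: comp_lin (bl _) (lact_linl bim _).
- exact: comp_lin (ract_linl bim _) (lact_linl bim _).
rewrite VG_lact_elt VG_ract_elt VG_bracketE !gact_vb linearZl linearZr /=.
rewrite !(linZ (VG_ract_linl _)) bracket_ve (linZ (VG_lact_linr _ _)).
rewrite VG_lractA kappa_inv !(linZ (VG_ract_linl _)) !VG_ract_gelt2 !scalerA.
rewrite chiM !mulgA; congr (_ *: _).
by ring.
Qed.

Lemma bracket_balanced r x y : br (ract bim x r) y = br x (lact bim r y).
Proof.
have bl := VG_bracket_linl act kappa; have br_ := VG_bracket_linr act kappa.
apply: (VG_eq_at (f := fun x => br (ract bim x r) y)
  (f' := fun x => br x (lact bim r y))) => [||i h _].
- exact: comp_lin (bl _) (ract_linl bim r).
- exact: bl.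
apply: (VG_eq_at (f := fun y => br (ract bim (ve i h) r) y)
  (f' := fun y => br (ve i h) (lact bim r y))) => [||j k _].
- exact: br_.
- exact: comp_lin (br_ _) (lact_linr bim r).
apply: (KG_eq (f := fun r => br (ract bim (ve i h) r) (ve j k))
  (f' := fun r => br (ve i h) (lact bim r (ve j k)))) => [||g] /=.
- exact: comp_lin (bl _) (ract_linr bim _).
- exact: comp_lin (br_ _) (lact_linl bim _).
by rewrite VG_lact_elt VG_ract_elt !VG_bracketE -gactM mulgA.
Qed.

Hypotheses (abG : abelian [set: gT]) (two_neq0 : 2%:R != 0 :> K).
Hypotheses (q_quantum : quantum_params q) (kappa_q : parameter_function q kappa).
Hypothesis kappa_chi : forall i j h r g,
  kap i j h 0 r != 0 -> act r g = act i g * act j g.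
Hypothesis jacobi_distinct : forall i j k, i != j -> i != k -> j != k ->
  q k i *: br (ve i 1%g) (kap j k) + q i j *: br (ve j 1%g) (kap k i)
   + q j k *: br (ve k 1%g) (kap i j) = 0.
Local Notation eps := (color_bichar act q).

Lemma gmulC (g h : gT) : (g * h = h * g)%g.
Proof. by apply: (centsP abG); rewrite inE. Qed.

(** As q_ii = 1, this element is its own opposite, and 2 is invertible. *)
Lemma kappa_diag i : kap i i = 0.
Proof.
have [_ q1 _] := q_quantum.
have := kappa_q i i; rewrite q1 scale1r => /eqP; rewrite -addr_eq0 -mulr2n -scaler_nat.
by rewrite scaler_eq0 (negPf two_neq0) => /eqP.
Qed.

(** If two indices agree, one term vanishes by [kappa_diag] and the other two cancel by the
    q-antisymmetry of kappa. *)
Lemma bracket_jacobi_vb i j k :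
  q k i *: br (ve i 1%g) (kap j k) + q i j *: br (ve j 1%g) (kap k i)
   + q j k *: br (ve k 1%g) (kap i j) = 0.
Proof.
have [_ q1 _] := q_quantum.
have br_ := VG_bracket_linr act kappa.
have brN x y : br x (- y) = - br x y by rewrite -scaleN1r (linZ (br_ x)) scaleN1r.
have [<-|ij] := eqVneq i j.
  rewrite kappa_diag (lin0 (br_ _)) scaler0 addr0 q1 scale1r (kappa_q k i).
  by rewrite brN (linZ (br_ _)) subrr.
have [<-|ik] := eqVneq i k.
  rewrite kappa_diag (lin0 (br_ _)) scaler0 addr0 q1 scale1r (kappa_q j i).
  by rewrite brN (linZ (br_ _)) addNr.
have [<-|jk] := eqVneq j k; last exact: jacobi_distinct.
rewrite kappa_diag (lin0 (br_ _)) scaler0 add0r q1 scale1r (kappa_q i j).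
by rewrite brN (linZ (br_ _)) subrr.
Qed.

(** The element g scales each v_r that occurs in kappa(v_j, v_k) by chi_r(g); by [kappa_chi] this is
    the same scalar chi_j(g) chi_k(g) for all of them, so it factors out. *)
Lemma bracket_ve_kappa i g j k m :
  br (ve i g) (VG_ract (kap j k) (gelt K m))
    = (act j g * act k g) *: VG_ract (br (ve i 1%g) (kap j k)) (gelt K (g * m)%g).
Proof.
have br_ := VG_bracket_linr act kappa.
apply: (VG_eq_at (f := fun x => br (ve i g) (VG_ract x (gelt K m)))
  (f' := fun x => (act j g * act k g) *:
     VG_ract (br (ve i 1%g) x) (gelt K (g * m)%g))) => [||r h nz].
- exact: comp_lin (br_ _) (VG_ract_linl _).
- move=> c x y; rewrite br_ VG_ract_linl scalerDr !scalerA.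
  by rewrite [_ * c]mulrC.
rewrite VG_ract_elt !bracket_ve chi1 scale1r VG_ract_gelt2 mul1g (kappa_chi _ nz).
by rewrite !mulgA [(g * h)%g]gmulC.
Qed.

(** The factor chi_k(g) of [bracket_ve_kappa] cancels against the bicharacter. The scalar in front
    of the right-hand side is invariant under cyclic rotation of (i, g), (j, h), (k, l), and so is
    the group element ghl because G is abelian. *)
Lemma bracket_jacobi_term i g j h k l :
  eps (deg_v gT k * deg_g n l)%g (deg_v gT i * deg_g n g)%g
     *: br (ve i g) (br (ve j h) (ve k l))
  = (act i l * act j g * act k h) *: VG_ract (q k i *: br (ve i 1%g) (kap j k))
      (gelt K (g * h * l)%g).
Proof.
rewrite bracket_ve (linZ (VG_bracket_linr act kappa _)) bracket_ve_kappa.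
rewrite color_bicharE (linZ (VG_ract_linl _)) !scalerA !mulgA; congr (_ *: _).
by have := chi_neq0 act k g => z0; field.
Qed.

Lemma bracket_color_lie : ungraded_color_lie_ring eps (@KG_grading K gT n)
  bim (@VG_grading K gT n) br.
Proof.
have bl := VG_bracket_linl act kappa; have br_ := VG_bracket_linr act kappa.
have b0l y : br 0 y = 0 := lin0 (bl y).
have b0r x : br x 0 = 0 := lin0 (br_ x).
split.
- by move=> a b; rewrite !ZnG_mulE addrC gmulC.
- exact: color_bichar_antisym.
- exact: KG_graded_alg.
- exact: VG_graded_bimodule.
- exact: bl.
- exact: br_.
- exact: bracket_bilin.
- exact: bracket_balanced.
- move=> x y a b xa yb.
  (* Zero is treated apart: its degree is 1 by convention, and [hdeg_VGP] concerns nonzero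
     elements. *)
  case: (eqVneq x 0) => [->|/eqP x0]; first by rewrite b0l b0r scaler0 oppr0.
  case: (eqVneq y 0) => [->|/eqP y0]; first by rewrite b0l b0r scaler0 oppr0.
  have [c [i [g [-> ->]]]] := hdeg_VGP xa x0.
  have [d [j [h [-> ->]]]] := hdeg_VGP yb y0.
  rewrite !(linZ (bl _)) !(linZ (br_ _)) !bracket_ve color_bicharE.
  rewrite kappa_q -scaleNr (linZ (VG_ract_linl _)) -scaleNr !scalerA [(h * g)%g]gmulC.
  congr (_ *: _).
  by have := chi_neq0 act i h => z0; field.
move=> x y z a b c xa yb zc.
case: (eqVneq x 0) => [->|/eqP x0].
  by rewrite !(b0l, b0r) !scaler0 !addr0.
case: (eqVneq y 0) => [->|/eqP y0].
  by rewrite !(b0l, b0r) !scaler0 !addr0.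
case: (eqVneq z 0) => [->|/eqP z0].
  by rewrite !(b0l, b0r) !scaler0 !addr0.
have [cx [i [g [-> ->]]]] := hdeg_VGP xa x0.
have [cy [j [h [-> ->]]]] := hdeg_VGP yb y0.
have [cz [k [l [-> ->]]]] := hdeg_VGP zc z0.
have scal3 u u1 u2 u3 x1 x2 x3 :
    u *: br (u1 *: x1) (br (u2 *: x2) (u3 *: x3))
    = (u1 * u2 * u3) *: (u *: br x1 (br x2 x3)).
  rewrite (linZ (bl _)) (linZ (bl _)) !(linZ (br_ _)) !scalerA; congr (_ *: _).
  by ring.
rewrite !scal3 !bracket_jacobi_term !scalerA.
(* The three group elements are brought to the form ghl and the three scalars to [u]; the sum is
   then a multiple of the identity for v_i, v_j, v_k. *)
rewrite [(h * l * g)%g]gmulC -[(l * g * h)%g]mulgA [(l * _)%g]gmulC !mulgA.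
set u := _ * _; set v := _ * _; set w := _ * _.
have -> : v = u by rewrite /u /v; ring.
have -> : w = u by rewrite /u /w; ring.
rewrite -!scalerDr -!(linD (VG_ract_linl _)) bracket_jacobi_vb.
by rewrite (lin0 (VG_ract_linl _)) scaler0.
Qed.
End ColorLieRing.

(** * Injectivity of V (x) KG into the quotient from the PBW basis *)

Section PBWInjectivity.
Variables (K : fieldType) (gT : finGroupType) (n : nat).
Variables (S : algType K) (al : alg_action S gT) (iota : {linear 'rV[K]_n -> S}).
Local Notation elt := (skew_elt al).
Local Notation vi i := (iota (vb K i)).
Local Notation inV := (skew_in al iota).

Variables (N : lmodType K) (f : {linear skew_alg al -> N}).

(** The elements v_i g are the PBW monomials of degree one, hence part of a basis, and the
    coordinates of [x] are the coefficients of its image on them. *)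
Lemma skew_in_inj :
  is_basis (fun mg : {ffun 'I_n -> nat} * gT =>
              f (elt (\prod_(i < n) vi i ^+ mg.1 i) mg.2)) ->
  forall x, f (inV x) = 0 -> x = 0.
Proof.
case=> free _ x fx0.
pose m (p : 'I_n * gT) : {ffun 'I_n -> nat} * gT := ([ffun i => (i == p.1) : nat], p.2).
have m_inj : injective m.
  move=> [i g] [j h] [/ffunP/(_ i)]; rewrite !ffunE eqxx => ij ->.
  by congr pair; apply/eqP; case: eqP ij.
have mE p : elt (\prod_(i < n) vi i ^+ (m p).1 i) (m p).2 = inV (vtens (vb K p.1) p.2).
  rewrite skew_in_vtens; congr (elt _ _).
  transitivity (\prod_(i | i == p.1) vi i); last by rewrite big_pred1_eq.
  by rewrite [RHS]big_mkcond; apply: eq_bigr => i _; rewrite ffunE; case: eqP.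
(* Linear independence needs coefficients indexed by all monomials: [c] is the coordinate of [x] on
   the monomials [m p] and 0 elsewhere, the sum having at most one term as [m] is injective. *)
pose c mg := \sum_(p | m p == mg) x p.2 0 p.1.
have cE p : c (m p) = x p.2 0 p.1.
  by rewrite /c (eq_bigl (pred1 p)) ?big_pred1_eq // => p'; rewrite /= (inj_eq m_inj).
have sum0 : \sum_(mg <- map m (index_enum _))
    c mg *: f (elt (\prod_(i < n) vi i ^+ mg.1 i) mg.2) = 0.
  rewrite big_map -[RHS]fx0 [x in RHS]VG_decomp exchange_big pair_big /=.
  rewrite (lin_sum _ _ (skew_in_linear al iota)) linear_sum; apply: eq_bigr => p _.
  by rewrite cE mE (linZ (skew_in_linear al iota)) linearZ.
apply/ffunP=> g; apply/rowP=> i; rewrite ffunE mxE -(cE (i, g)).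
apply: (free _ _ _ sum0); last by rewrite map_f ?mem_index_enum.
by rewrite map_inj_uniq ?index_enum_uniq.
Qed.
End PBWInjectivity.

(** * Isomorphisms induced on quotient algebras *)

Section QuotientIsomorphism.
Local Notation repr := generic_quotient.repr.
Variables (K : comNzRingType) (B1 B2 : algType K) (S1 : B1 -> Prop) (S2 : B2 -> Prop).
Variables (f : B1 -> B2) (g : B2 -> B1).

Lemma quot_pi_eq0 (B B' : algType K) (S : B -> Prop) (S' : B' -> Prop) (k : B -> B') :
  linear k -> monoid_morphism k -> (forall x, S x -> quot_pi S' (k x) = 0) ->
  forall x, span (ideal_gens S) x -> quot_pi S' (k x) = 0.
Proof.
move=> kl [_ kM] kS x; elim=> [|_ [a [s [b [Ss ->]]]]|c y z _ IHy _ IHz].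
- by rewrite (lin0 kl) linear0.
- by rewrite !kM !quot_piM (kS _ Ss) mulr0 mul0r.
- by rewrite kl linearP /= IHy IHz scaler0 addr0.
Qed.

Hypotheses (f_lin : linear f) (f_mon : monoid_morphism f).
Hypotheses (g_lin : linear g) (g_mon : monoid_morphism g).
Hypotheses (fK : cancel f g) (gK : cancel g f).
Hypothesis f_rel : forall x, S1 x -> quot_pi S2 (f x) = 0.
Hypothesis g_rel : forall x, S2 x -> quot_pi S1 (g x) = 0.

(** The induced map is defined through chosen representatives; this shows that the choice does not
    matter. *)
Lemma quot_pi_congr (B B' : algType K) (S : B -> Prop) (S' : B' -> Prop) (k : B -> B') :
  linear k -> monoid_morphism k -> (forall x, S x -> quot_pi S' (k x) = 0) ->
  forall x, quot_pi S' (k (repr (quot_pi S x))) = quot_pi S' (k x).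
Proof.
move=> kl km kS x; apply/eqP; rewrite -subr_eq0 -linearB /=.
rewrite -scaleN1r addrC -kl addrC scaleN1r; apply/eqP.
exact: (quot_pi_eq0 kl km kS) (repr_qpi _ x).
Qed.

Lemma quot_alg_iso :
  exists F : {rmorphism quot_alg S1 -> quot_alg S2}, scalable F /\ bijective F.
Proof.
pose F (x : quot_alg S1) : quot_alg S2 := quot_pi S2 (f (repr x)).
pose G (x : quot_alg S2) : quot_alg S1 := quot_pi S1 (g (repr x)).
have FE x : F (quot_pi S1 x) = quot_pi S2 (f x) := quot_pi_congr f_lin f_mon f_rel x.
have GE x : G (quot_pi S2 x) = quot_pi S1 (g x) := quot_pi_congr g_lin g_mon g_rel x.
have piK (B : algType K) (S : B -> Prop) (x : quot_alg S) : quot_pi S (repr x) = x.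
  exact: qpi_repr.
have F_lin : linear F.
  by move=> c x y; rewrite -[x]piK -[y]piK -linearP !FE f_lin linearP.
have F_add : zmod_morphism F.
  by move=> x y; rewrite -scaleN1r addrC F_lin scaleN1r addrC.
have F_mon : monoid_morphism F.
  split; first by rewrite -[1]/(quot_pi S1 1) FE f_mon.1.
  by move=> x y; rewrite -[x]piK -[y]piK -quot_piM !FE f_mon.2 quot_piM.
pose FA := GRing.isZmodMorphism.Build (quot_alg S1) (quot_alg S2) F F_add.
pose FM := GRing.isMonoidMorphism.Build (quot_alg S1) (quot_alg S2) F F_mon.
pose FR : {rmorphism quot_alg S1 -> quot_alg S2} := HB.pack F FA FM.
exists FR; split; first exact: (linZ F_lin).
apply: (Bijective (g := G)) => x; rewrite -[x]piK.
  by rewrite [FR _]FE GE fK.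
by rewrite GE [FR _]FE gK.
Qed.
End QuotientIsomorphism.

(** * The universal property of the skew group algebra *)

Section SkewLift.
Variables (K : fieldType) (gT : finGroupType) (S : algType K) (al : alg_action S gT).
Variables (C : algType K) (phi : S -> C) (gam : gT -> C).
Hypotheses (phi_lin : linear phi) (phi_mon : monoid_morphism phi).
Hypotheses (gam1 : gam 1%g = 1) (gamM : forall g h, gam (g * h)%g = gam g * gam h).
Hypothesis gam_phi : forall g s, gam g * phi s = phi (al g s) * gam g.

Definition skew_lift (a : skew_alg al) : C := \sum_g phi (a g) * gam g.

Lemma skew_lift_linear : linear skew_lift.
Proof.
move=> c a b; rewrite /skew_lift scaler_sumr -big_split; apply: eq_bigr => g _ /=.
by rewrite !ffunE phi_lin mulrDl scalerAl.
Qed.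

Lemma skew_lift_elt s g : skew_lift (skew_elt al s g) = phi s * gam g.
Proof.
rewrite /skew_lift (bigD1 g) //= ffunE eqxx big1 ?addr0 // => h ne.
by rewrite ffunE (negPf ne) (lin0 phi_lin) mul0r.
Qed.

Lemma skew_lift_monoid : monoid_morphism skew_lift.
Proof.
split; first by rewrite (skew_lift_elt 1 1%g) phi_mon.1 gam1 mulr1.
move=> a b; rewrite [a]skew_sum [b]skew_sum mulr_suml !(lin_sum _ _ skew_lift_linear) mulr_suml.
apply: eq_bigr => g _; rewrite !mulr_sumr (lin_sum _ _ skew_lift_linear).
apply: eq_bigr => h _; rewrite skew_eltME !skew_lift_elt phi_mon.2 gamM.
by rewrite -!mulrA; congr (_ * _); rewrite !mulrA gam_phi.
Qed.
End SkewLift.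

(** Homogeneous elements of L are multiples of basis elements; the scalars [c] and [d] are taken out
    of a relation of U(L) here. *)
Lemma color_commutator_morph (K : fieldType) (C D : algType K) (F : C -> D)
    (x y z : C) (x' y' z' : D) (c d e : K) : linear F -> monoid_morphism F ->
  F x = x' -> F y = y' -> F z = z' ->
  F ((c *: x) * (d *: y) - e *: ((d *: y) * (c *: x)) - (c * d) *: z)
    = (c * d) *: (x' * y' - e *: (y' * x') - z').
Proof.
move=> Fl [_ FM] <- <- <-; rewrite -!FM -(linZ Fl) -!(linB Fl) -(linZ Fl); congr F.
rewrite -!scalerAl -!scalerAr !scalerBr !scalerA; congr (_ - _ *: _ - _).
by ring.
Qed.

(** * The skew group algebra against the tensor algebra of L, and their relations *)

Section EnvelopingIsomorphism.
Variables (K : fieldType) (gT : finGroupType) (n : nat) (act : diag_action K gT n).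
Variables (q : 'I_n -> 'I_n -> K).
Variable kappa : {bilinear 'rV[K]_n -> 'rV[K]_n -> VG K gT n}.
Hypotheses (abG : abelian [set: gT]).
Variables (S : algType K) (al : alg_action S gT) (iota : {linear 'rV[K]_n -> S}).
Hypothesis al_iota : forall g v, al g (iota v) = iota (gact act g v).
Local Notation bim := (VG_bimodule act).
Local Notation T := (tensor_alg bim).
Local Notation elt := (skew_elt al).
Local Notation vi i := (iota (vb K i)).
Local Notation kap i j := (kappa (vb K i) (vb K j)).
Local Notation br := (VG_bracket act kappa).
Local Notation inV := (skew_in al iota).
Local Notation ve i g := (vtens (vb K i) g).
Local Notation eps := (color_bichar act q).
Local Notation urel := (univ_env_rel eps (@VG_grading K gT n) br).
Local Notation srel := (@skew_rel K gT n q kappa S al iota).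
Local Notation tin := (tens_in bim).

(** One has (v_i g)(v_j h) = chi_j(g) v_i v_j gh, and the bicharacter times (v_j h)(v_i g) is
    chi_j(g) q_ij v_j v_i gh. The whole expression is therefore chi_j(g) times a defining relation
    times gh. *)
Lemma skew_rel_bracket i g j h :
  quot_pi srel (inV (ve i g) * inV (ve j h)
    - eps (deg_v gT i * deg_g n g)%g (deg_v gT j * deg_g n h)%g
        *: (inV (ve j h) * inV (ve i g)) - inV (br (ve i g) (ve j h))) = 0.
Proof.
have inVl := skew_in_linear al iota.
have eltZ c s k := linZ (skew_elt_linear al k) c s.
rewrite bracket_ve (linZ inVl) skew_in_ract // !skew_in_vtens !skew_eltME !al_iota !gact_vb.
rewrite !(linZ (linearP iota)) -!scalerAr !eltZ color_bicharE [(h * g)%g](gmulC abG).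
rewrite scalerA.
have -> : q i j * (act i h)^-1 * act j g * act i h = act j g * q i j.
  by have := chi_neq0 act i h => z0; field.
rewrite -scalerA -!scalerBr linearZ /= -skew_eltBZ skew_elt_in -mulrBl quot_piM.
by rewrite linearB /= skew_relE subrr mul0r !scaler0.
Qed.

Definition tens_elt (g : gT) : T := tens_scal bim (gelt K g).
Definition tens_to_skew : T -> skew_alg al := tens_lift (KG_in al) inV.

Let KGl := KG_in_linear al.
Let inVl := skew_in_linear al iota.
Let inV_lact r x : inV (lact bim r x) = KG_in al r * inV x := skew_in_lact al_iota r x.
Let inV_ract x r : inV (ract bim x r) = inV x * KG_in al r := skew_in_ract al iota x r.

Lemma tens_to_skew_linear : linear tens_to_skew.
Proof. exact: tens_lift_linear KGl inVl inV_lact inV_ract. Qed.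

Lemma tens_to_skew_monoid : monoid_morphism tens_to_skew.
Proof.
split; first exact: tens_lift1 (KG_in1 al) inVl inV_lact inV_ract.
exact: tens_liftM (KG_inM al) inVl inV_lact inV_ract.
Qed.

Lemma tens_to_skew_in x : tens_to_skew (tin x) = inV x.
Proof. exact: tens_lift_in KGl inVl inV_lact inV_ract x. Qed.

Lemma tens_to_skew_scal r : tens_to_skew (tens_scal bim r) = KG_in al r.
Proof. exact: tens_liftr inVl inV_lact inV_ract r. Qed.

Lemma tens_elt1 : tens_elt 1%g = 1.
Proof. by []. Qed.

Lemma tens_eltM g h : tens_elt (g * h)%g = tens_elt g * tens_elt h.
Proof. by rewrite /tens_elt -geltM tens_scalM. Qed.

Lemma tens_elt_commute g v :
  tens_elt g * tin (vtens v 1%g) = tin (vtens (gact act g v) 1%g) * tens_elt g.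
Proof.
rewrite /tens_elt -tens_in_lact -tens_in_ract /= VG_lact_elt VG_ract_elt.
by rewrite mulg1 mul1g.
Qed.

Variable phi : S -> T.
Hypotheses (phi_lin : linear phi) (phi_mon : monoid_morphism phi).
Hypothesis phi_iota : forall v, phi (iota v) = tin (vtens v 1%g).
Hypothesis phi_commute : forall g s, tens_elt g * phi s = phi (al g s) * tens_elt g.
Hypothesis phiK : forall s, tens_to_skew (phi s) = elt s 1%g.

Local Notation Phi := (skew_lift phi tens_elt).
Let Phi_lin := @skew_lift_linear K gT S al T phi tens_elt phi_lin.
Let Phi_mon := @skew_lift_monoid K gT S al T phi tens_elt phi_lin phi_mon
  tens_elt1 tens_eltM phi_commute.

Lemma skew_to_tensK : cancel Phi tens_to_skew.
Proof.
move=> a; rewrite [in RHS](skew_sum a) /skew_lift (lin_sum _ _ tens_to_skew_linear).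
apply: eq_bigr => g _; rewrite tens_to_skew_monoid.2 phiK tens_to_skew_scal.
by rewrite -skew_elt_in.
Qed.

Lemma skew_to_tens_in x : Phi (inV x) = tin x.
Proof.
apply: (VG_eq_at (f := fun x => Phi (inV x)) (f' := tin)) => [||i g _].
- exact: comp_lin Phi_lin inVl.
- exact: tens_in_linear.
rewrite skew_in_vtens skew_lift_elt // phi_iota /tens_elt -tens_in_ract.
by rewrite [ract _ _ _]VG_ract_elt mul1g.
Qed.

Lemma skew_to_tens_KG r : Phi (KG_in al r) = tens_scal bim r.
Proof.
apply: (KG_eq (f := fun r => Phi (KG_in al r)) (f' := tens_scal bim)) => [||g].
- exact: comp_lin Phi_lin KGl.
- exact: tens_scal_linear.
by rewrite KG_in_gelt skew_lift_elt // phi_mon.1 mul1r.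
Qed.

Lemma tens_to_skewK : cancel tens_to_skew Phi.
Proof.
elim/tens_ind=> [c a b aK bK|r|s].
- by rewrite tens_to_skew_linear Phi_lin aK bK.
- by rewrite tens_to_skew_scal skew_to_tens_KG.
elim: s => [|x s IHs]; first by rewrite big_nil tens_to_skew_monoid.1 Phi_mon.1.
rewrite big_cons tens_to_skew_monoid.2 Phi_mon.2 IHs.
by rewrite tens_to_skew_in skew_to_tens_in.
Qed.

(** A defining relation of the skew side is the relation of U(L) for v_i (x) 1 and v_j (x) 1, where
    the bicharacter is q_ij and the bracket is kappa(v_i, v_j). *)
Lemma skew_to_tens_rel x : srel x -> quot_pi urel (Phi x) = 0.
Proof.
move=> [i [j ->]]; apply: qpi_gen.
exists 1, (Phi (elt (vi i * vi j - q i j *: (vi j * vi i)) 1%g - inV (kap i j))), 1.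
rewrite mul1r mulr1; split=> //.
exists (ve i 1%g), (ve j 1%g), (deg_v gT i * deg_g n 1)%g, (deg_v gT j * deg_g n 1)%g.
split; [exact: hdeg_vtens | exact: hdeg_vtens |].
rewrite color_bicharE !chi1 invr1 !mulr1 VG_bracketE gact1 mulg1 VG_ract1.
rewrite (linB Phi_lin) skew_to_tens_in; congr (_ - _).
rewrite skew_lift_elt // tens_elt1 mulr1.
by rewrite (linB phi_lin) (linZ phi_lin) !phi_mon.2 !phi_iota.
Qed.

Lemma tens_to_skew_rel t : urel t -> quot_pi srel (tens_to_skew t) = 0.
Proof.
have bl := VG_bracket_linl act kappa; have br_ := VG_bracket_linr act kappa.
have tinl := tens_in_linear bim.
move=> [x [y [a [b [xa yb ->]]]]].
case: (eqVneq x 0) => [->|/eqP x0].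
  rewrite (lin0 (bl _)) (lin0 tinl) mul0r mulr0 scaler0 !subr0.
  by rewrite (lin0 tens_to_skew_linear) linear0.
case: (eqVneq y 0) => [->|/eqP y0].
  rewrite (lin0 (br_ _)) (lin0 tinl) mul0r mulr0 scaler0 !subr0.
  by rewrite (lin0 tens_to_skew_linear) linear0.
have [c [i [g [-> ->]]]] := hdeg_VGP xa x0.
have [d [j [h [-> ->]]]] := hdeg_VGP yb y0.
rewrite (linZ (bl _)) (linZ (br_ _)) !(linZ tinl) scalerA.
rewrite (color_commutator_morph _ _ _ tens_to_skew_linear tens_to_skew_monoid
  (tens_to_skew_in _) (tens_to_skew_in _) (tens_to_skew_in _)).
by rewrite linearZ /= skew_rel_bracket scaler0.
Qed.

Lemma skew_quot_iso : exists F : {rmorphism @quot_alg K (skew_alg al) srel ->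
    univ_env eps bim (@VG_grading K gT n) br},
  scalable F /\ bijective F.
Proof.
exact: (@quot_alg_iso K (skew_alg al) T srel urel Phi tens_to_skew
  Phi_lin Phi_mon tens_to_skew_linear tens_to_skew_monoid
  skew_to_tensK tens_to_skewK skew_to_tens_rel tens_to_skew_rel).
Qed.
End EnvelopingIsomorphism.

(** * The universal property of T(V) *)

Section TensorAlgebraOfSpace.
Variables (K : fieldType) (n : nat).
Local Notation V := 'rV[K]_n.
Local Notation bim := (scalar_bimodule K n).

Lemma tv_in_linear : linear (@tv_in K n).
Proof. exact: tens_in_linear. Qed.
HB.instance Definition _ :=
  GRing.isLinear.Build K V (TV K n) *:%R (@tv_in K n) tv_in_linear.

Lemma TV_ind (P : TV K n -> Prop) :
  (forall c a b, P a -> P b -> P (c *: a + b)) -> P 1 ->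
  (forall a b, P a -> P b -> P (a * b)) -> (forall v, P (tv_in v)) ->
  forall s, P s.
Proof.
move=> PZ P1 PM Pv; have P0 : P 0 by rewrite -(addNr 1) -scaleN1r; apply: PZ.
apply: tens_ind => [c a b|r|s]; first exact: PZ.
  by rewrite tv_scalE /tv_scal -[_ *: _]addr0; apply: PZ.
elim: s => [|x s IHs]; first by rewrite big_nil.
by rewrite big_cons; apply: PM => //; apply: Pv.
Qed.

(** The elements [s] satisfying the identity form a subalgebra, so the generators decide. With [c] =
    1 this is uniqueness of algebra morphisms out of T(V); with [c] a group element it is the
    commutation rule of a skew group algebra. *)
Lemma TV_intertwine (D : algType K) (F G : TV K n -> D) (c : D) :
  linear F -> monoid_morphism F -> linear G -> monoid_morphism G ->
  (forall v, c * F (tv_in v) = G (tv_in v) * c) -> forall s, c * F s = G s * c.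
Proof.
move=> Fl [F1 FM] Gl [G1 GM] FG; apply: TV_ind => [d a b IHa IHb||a b IHa IHb|//].
- by rewrite Fl Gl mulrDr mulrDl -scalerAr -scalerAl IHa IHb.
- by rewrite F1 G1 mulr1 mul1r.
- by rewrite FM GM mulrA IHa -mulrA IHb mulrA.
Qed.

Variables (C : algType K) (u : V -> C).
Hypothesis u_lin : linear u.

Definition tv_lift : TV K n -> C := tens_lift (fun c : K^o => (c : K) *: (1 : C)) u.

Let scl : linear (fun c : K^o => (c : K) *: (1 : C)).
Proof. by move=> c r s; rewrite scalerDl scalerA. Qed.
Let scM : {morph (fun c : K^o => (c : K) *: (1 : C)) : r s / r * s}.
Proof. by move=> r s /=; rewrite -scalerAl mul1r scalerA. Qed.
Let ul r x : u (lact bim r x) = ((r : K) *: 1) * u x.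
Proof. by rewrite [lact _ _ _]/(r *: x) (linZ u_lin) -scalerAl mul1r. Qed.
Let ur x r : u (ract bim x r) = u x * ((r : K) *: 1).
Proof. by rewrite [ract _ _ _]/(r *: x) (linZ u_lin) -scalerAr mulr1. Qed.

Lemma tv_lift_linear : linear tv_lift.
Proof. exact: tens_lift_linear scl u_lin ul ur. Qed.

Lemma tv_lift_monoid : monoid_morphism tv_lift.
Proof.
split; first exact: (@tens_lift1 K _ V bim C _ _ (scale1r _) u_lin ul ur).
exact: tens_liftM scM u_lin ul ur.
Qed.

Lemma tv_lift_in v : tv_lift (tv_in v) = u v.
Proof. exact: tens_lift_in scl u_lin ul ur v. Qed.

Lemma tv_lift_commute (gT : finGroupType) (act : diag_action K gT n) g c :
  (forall v, c * u v = u (gact act g v) * c) ->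
  forall s, c * tv_lift s = tv_lift (tv_act act g s) * c.
Proof.
move=> cu; have [l1 lM] := tv_lift_monoid; have [a1 aM] := tv_act_monoid act g.
apply: (TV_intertwine tv_lift_linear tv_lift_monoid
  (G := fun s => tv_lift (tv_act act g s))) => [||v].
- exact: comp_lin tv_lift_linear (tv_act_linear act g).
- by split=> [|a b]; rewrite ?a1 ?aM.
by rewrite (tv_lift_in v) (tv_act_in act g v) (tv_lift_in (gact act g v)).
Qed.
End TensorAlgebraOfSpace.

(** * Parts (c) and (b) for T(V) itself: the isomorphism and the Yetter-Drinfeld condition *)

Section DrinfeldEnveloping.
Variables (K : fieldType) (gT : finGroupType) (n : nat) (act : diag_action K gT n).
Variables (q : 'I_n -> 'I_n -> K).
Variable kappa : {bilinear 'rV[K]_n -> 'rV[K]_n -> VG K gT n}.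

(** The passage from the abstract algebra [S] to T(V); both sides agree by conversion. *)
Lemma H_rel_skew : @H_rel K gT n act q kappa
  = @skew_rel K gT n q kappa (TV K n) (tv_action act) (@tv_in K n).
Proof. by []. Qed.

Lemma H_alg_iso : abelian [set: gT] ->
  exists f : {rmorphism H_alg act q kappa ->
      univ_env (color_bichar act q) (VG_bimodule act) (@VG_grading K gT n)
        (VG_bracket act kappa)},
    scalable f /\ bijective f.
Proof.
move=> abG; pose u v := tens_in (VG_bimodule act) (vtens v 1%g).
have u_lin : linear u.
  move=> c x y; rewrite /u -tens_in_linear; congr (tens_in _ _).
  by apply/ffunP=> g; rewrite !ffunE; case: eqP => // _; rewrite scaler0 addr0.
have al_iota g v : tv_action act g (tv_in v) = tv_in (gact act g v) := tv_act_in act g v.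
have u_commute g s :
    tens_elt act g * tv_lift u s = tv_lift u (tv_action act g s) * tens_elt act g.
  by apply: (tv_lift_commute u_lin) => v; exact: tens_elt_commute.
have Psil := tens_to_skew_linear al_iota; have [Psi1 PsiM] := tens_to_skew_monoid al_iota.
have [l1 lM] := tv_lift_monoid u_lin.
pose Psi_phi s := @tens_to_skew K gT n act (TV K n) (tv_action act) (@tv_in K n) (tv_lift u s).
have Psi_phiE s : Psi_phi s = skew_elt (tv_action act) s 1%g.
  (* The factors 1 give the equality of two morphisms on T(V) the shape of [TV_intertwine]. *)
  rewrite -[LHS]mul1r -[RHS]mulr1; move: s.
  apply: (TV_intertwine (F := Psi_phi) (comp_lin Psil (tv_lift_linear u_lin)) _
            (skew_elt_linear (tv_action act) 1%g)).
  - by split=> [|a b]; rewrite /Psi_phi ?l1 ?lM.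
  - by split=> //; apply: skew_elt1M.
  move=> v; rewrite mul1r mulr1 /Psi_phi (tv_lift_in u_lin v).
  by rewrite (tens_to_skew_in al_iota) skew_in_vtens.
have iso := @skew_quot_iso K gT n act q kappa abG (TV K n) (tv_action act) (@tv_in K n)
  al_iota (tv_lift u) (tv_lift_linear u_lin) (tv_lift_monoid u_lin) (tv_lift_in u_lin)
  u_commute Psi_phiE.
rewrite -H_rel_skew in iso.
exact iso.
Qed.

Lemma V_yetter_drinfeld : yetter_drinfeld act (color_bichar act q) (@V_grading K gT n)
  (@deg_g gT n) (@KG_grading K gT n) (@VG_grading K gT n).
Proof.
split=> [|g h|g a v va i h|g a v va].
- exact: V_grading_grading.
- by rewrite ffunE; case: (h =P g) => [->|_]; rewrite ?eqxx.
- rewrite ffunE; case: (h =P g) => [->|_]; last by rewrite mxE eqxx.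
  by move/va->.
case: (eqVneq v 0) => [->|/eqP v0]; first by rewrite linear0 scaler0.
have [c [i [-> ->]]] := hdeg_VP va v0.
by rewrite color_bichar_gv linearZ /= gact_vb !scalerA mulrC.
Qed.
End DrinfeldEnveloping.

Theorem theorem4p1 (K : fieldType) (gT : finGroupType) (n : nat)
    (act : diag_action K gT n) (q : 'I_n -> 'I_n -> K)
    (kappa : {bilinear 'rV[K]_n -> 'rV[K]_n -> VG K gT n}) :
  [pchar K] =i pred0 ->
  (0 < n)%N ->
  abelian [set: gT] ->
  quantum_params q ->
  parameter_function q kappa ->
  quantum_drinfeld_orbifold_algebra act q kappa ->
  vanishing_condition act q kappa ->
  exists eps : ZnG gT n -> ZnG gT n -> K,
    (* (a) *)
    [/\ antisym_bicharacter eps,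
        forall (g h : gT) (i j : 'I_n),
          eps (deg_v gT i * deg_g n g)%g (deg_v gT j * deg_g n h)%g
            = q i j * (act i h)^-1 * act j g,
    (* (b) *)
        ungraded_color_lie_ring eps (@KG_grading K gT n)
          (VG_bimodule act) (@VG_grading K gT n) (VG_bracket act kappa),
        yetter_drinfeld act eps (@V_grading K gT n) (@deg_g gT n)
          (@KG_grading K gT n) (@VG_grading K gT n) &
    (* (c) *)
        exists f : {rmorphism H_alg act q kappa ->
            univ_env eps (VG_bimodule act) (@VG_grading K gT n)
              (VG_bracket act kappa)},
          scalable f /\ bijective f].
Proof.
move=> charK _ abG q_quantum kappa_q pbw vanish.
have al_iota g v : tv_action act g (tv_in v) = tv_in (gact act g v) := tv_act_in act g v.
have inj : forall x, quot_pi (@skew_rel K gT n q kappa (TV K n) (tv_action act) (@tv_in K n))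
    (skew_in (tv_action act) (@tv_in K n) x) = 0 -> x = 0.
  by rewrite -H_rel_skew; apply: (skew_in_inj (f := quot_pi (@H_rel K gT n act q kappa))) pbw.
(* Characteristic zero gives 2 != 0, from which kappa(v_i, v_i) = 0 follows. *)
have two_neq0 : 2%:R != 0 :> K.
  by apply/negP => two0; have := charK 2; rewrite !inE two0.
have kappa_inv := kappa_invariant al_iota inj.
have kappa_chi := kappa_chi al_iota inj abG.
have jacobi := bracket_jacobi_distinct al_iota inj q_quantum vanish.
exists (color_bichar act q); split.
- exact: color_bichar_antisym.
- exact: color_bicharE.
- apply: bracket_color_lie => // i j h r g; exact: kappa_chi.
- exact: V_yetter_drinfeld.
- exact: H_alg_iso.
Qed.
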